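(* (i) If $K=[a,b]$ with $a<b$ real, then $B(K)=C^\infty([a,b])$. (ii) If $K=T=\{e^{i\theta}:\theta\in\mathbb R\}$, then $B(T)=C^\infty(T)$.
   Context: $\mathbb N_0=\{0,1,2,\dots\}$. For a compact $K\subset\mathbb C$: $A(K)$ is the set of functions $f:K\to\mathbb C$ continuous on $K$ and holomorphic in the interior of $K$. $O(K)$ is the set of functions $f$ holomorphic on some open set $V_f\supseteq K$ (depending on $f$), with the metric $$d(f,g)=\sum_{k=0}^\infty \frac1{2^k}\,\frac{\sup_{z\in K}|f^{(k)}(z)-g^{(k)}(z)|}{1+\sup_{z\in K}|f^{(k)}(z)-g^{(k)}(z)|},$$ where functions agreeing near $K$ are identified. A function $f\in O(K)$ is identified with the sequence $(f^{(k)}|_K)_{k\ge0}\in A(K)^{\mathbb N_0}$. $B(K)$ is the completion of $(O(K),d)$, realized as the set of sequences $(g_k)_{k\ge0}\in A(K)^{\mathbb N_0}$ for which there exist $f_n\in O(K)$ with $\sup_{z\in K}|f_n^{(k)}(z)-g_k(z)|\to0$ as $n\to\infty$ for every $k\in\mathbb N_0$. For $K=[a,b]$ or $K=T$, $C^\infty(K)$ is the set of functions $f:K\to\mathbb C$ that have derivatives of every order on $K$ with respect to the position, i.e. $f'(z_0)=\lim_{z\to z_0,\,z\in K\setminus\{z_0\}}\frac{f(z)-f(z_0)}{z-z_0}$ exists for all $z_0\in K$, and likewise iteratively for $f',f'',\dots$. Such an $f$ is identified with the sequence $(f,f',f'',\dots)$ of these derivatives, and the equalities in the claim are equalities of sets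 of sequences under this identification. *)

(* Defs.v *)
From Stdlib Require Import Reals.
From Coquelicot Require Import Coquelicot.
Local Open Scope R_scope.

(** Functions on a set [K] are represented by total functions [C -> C]; every
    predicate below depends only on their values on [K]. *)

Definition holomorphic_on (V : C -> Prop) (f : C -> C) : Prop :=
  forall z : C, V z -> ex_derive (K := C_AbsRing) (V := C_NormedModule) f z.

Definition interior (K : C -> Prop) : C -> Prop :=
  fun z => locally (T := C_UniformSpace) z K.

Definition A_space (K : C -> Prop) (f : C -> C) : Prop :=
  continuous_on (T := C_UniformSpace) (U := C_UniformSpace) K f /\
  holomorphic_on (interior K) f.

(** [f] is holomorphic on some open neighbourhood of [K], and [F k] is its
    [k]-th complex derivative there. *)
Definition O_space (K : C -> Prop) (f : C -> C) (F : nat -> C -> C) : Prop :=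
  exists V : C -> Prop,
    open (T := C_UniformSpace) V /\
    (forall z : C, K z -> V z) /\
    holomorphic_on V f /\
    (forall z : C, V z -> F O z = f z) /\
    (forall (k : nat) (z : C), V z ->
       is_derive (K := C_AbsRing) (V := C_NormedModule) (F k) z (F (S k) z)).

(** The supremum is taken in [Rbar], so that it is [p_infty] rather than a junk
    real value when the set is unbounded. *)
Definition sup_dist (K : C -> Prop) (f g : C -> C) : Rbar :=
  Lub_Rbar (fun x : R => exists z : C, K z /\ x = Cmod (f z - g z)%C).

Definition sup_cvg (K : C -> Prop) (f : nat -> C -> C) (g : C -> C) : Prop :=
  forall eps : posreal, eventually (fun n => Rbar_lt (sup_dist K (f n) g) eps).

Definition B_space (K : C -> Prop) (g : nat -> C -> C) : Prop :=
  (forall k : nat, A_space K (g k)) /\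
  exists (f : nat -> C -> C) (F : nat -> nat -> C -> C),
    (forall n : nat, O_space K (f n) (F n)) /\
    (forall k : nat, sup_cvg K (fun n => F n k) (g k)).

(** [l] is the limit of the difference quotients of [f] at [z0] along
    [K] minus [z0]. *)
Definition is_derive_within
    (K : C -> Prop) (f : C -> C) (z0 l : C) : Prop :=
  filterlim (fun z : C => ((f z - f z0) / (z - z0))%C)
    (within K (locally' (T := C_UniformSpace) z0))
    (locally (T := C_UniformSpace) l).

Definition derivatives_within
    (K : C -> Prop) (f : C -> C) (g : nat -> C -> C) : Prop :=
  (forall z : C, K z -> g O z = f z) /\
  (forall (k : nat) (z : C), K z -> is_derive_within K (g k) z (g (S k) z)).

(** The sequences [(f, f', f'', ...)] of the functions [f] having derivatives
    of every order on [K].  Only meant for [K] without isolated points, where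
    these derivatives are unique. *)
Definition Cinfty_space (K : C -> Prop) (g : nat -> C -> C) : Prop :=
  exists f : C -> C, derivatives_within K f g.

Definition segment (a b : R) : C -> Prop :=
  fun z => exists x : R, a <= x <= b /\ z = RtoC x.

Definition unit_circle : C -> Prop :=
  fun z => exists theta : R, z = (cos theta, sin theta).

(* Main.v *)
Require Import Defs.
From Stdlib Require Import Reals Lra Lia ZArith ClassicalEpsilon.
From Coquelicot Require Import Coquelicot.
From Stdlib Require Import List.
Local Open Scope R_scope.

(** Both directions rest on the mean value inequality along paths in [K] of length comparable
    to the chord.

    From [B_space] to [Cinfty_space], it gives first-order Taylor estimates for the
    approximants on [K] that are uniform along the sequence and pass to the limit.

    Conversely, it suffices to approximate [g 0, ..., g n] on [K] together with their
    derivatives by Laurent polynomials with pole off [K]. By induction on [n]: [g n] itself is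
    Lipschitz and is approximated by Bernstein polynomials (in two variables for the circle);
    then one takes primitives [n] times. A primitive exists once the [(z - c)^(-1)] term is
    removed, and that term is small because [g k] is a single-valued primitive of [g (k+1)] on
    the closed curve. *)

(** Derivatives within [K] carry no information off [K], so two points can only be compared through
    a path lying in [K]; bounding its length by the chord keeps Taylor remainders small relative to
    the distance. The general argument mainly asks four things of [K]: such paths, boundedness of
    continuous functions, approximability of Lipschitz functions, and a bound on residues. Segment
    and circle enter by verifying these.

    Closeness to [g 0] says nothing about derivatives, whereas integration costs only a constant
    factor; hence the induction starts at the highest derivative. The obstacle is topological: on
    the circle negative powers cannot be avoided, and [1/z] has no primitive there. On the segment
    nonnegative exponents turn the same argument into one about ordinary polynomials. *)

(** * Elementary inequalities for the complex modulus *)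

Lemma Cmod_minus_sym (a b : C) : Cmod (a - b) = Cmod (b - a).
Proof. rewrite <- Cmod_opp. f_equal. ring. Qed.

Lemma Cmod_minus_triangle (a b c : C) : Cmod (a - c) <= Cmod (a - b) + Cmod (b - c).
Proof. replace (a - c)%C with ((a - b) + (b - c))%C by ring. apply Cmod_triangle. Qed.

Lemma Cmod_minus_self (a : C) : Cmod (a - a) = 0.
Proof. replace (a - a)%C with (RtoC 0) by ring. apply Cmod_0. Qed.

Lemma Cminus_eq_0 (w z : C) : (w - z)%C = 0 -> w = z.
Proof. intros E. replace w with (w - z + z)%C by ring. rewrite E. ring. Qed.

Lemma Cmod_le_abs (z : C) : Cmod z <= Rabs (fst z) + Rabs (snd z).
Proof.
  destruct z as [x y]; simpl.
  replace (x, y) with (RtoC x + (0, y))%C by (unfold RtoC, Cplus; simpl; f_equal; ring).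
  eapply Rle_trans; [apply Cmod_triangle|].
  apply Rplus_le_compat.
  - rewrite Cmod_R. lra.
  - unfold Cmod; simpl. right.
    replace (0 * (0 * 1) + y * (y * 1)) with (Rsqr y) by (unfold Rsqr; ring).
    apply sqrt_Rsqr_abs.
Qed.

(** * Derivatives within a set *)

(** The uniform structure on [C] is the product one, whose balls are squares; inscribing a square in
    a disc costs the factor [sqrt 2]. *)
Lemma locally_Cmod (z : C) (P : C -> Prop) :
  locally (T := C_UniformSpace) z P <->
  exists d : R, 0 < d /\ forall w : C, Cmod (w - z) < d -> P w.
Proof.
  split.
  - intros [d H]. exists d. split; [apply cond_pos|].
    intros w Hw. apply H. apply C_NormedModule_mixin_compat1. exact Hw.
  - intros [d [Hd H]].
    assert (Hs : 0 < sqrt 2) by (apply sqrt_lt_R0; lra).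
    assert (Hd' : 0 < d / sqrt 2) by (apply Rdiv_lt_0_compat; lra).
    exists (mkposreal _ Hd'). intros w Hw. apply H.
    assert (E := C_NormedModule_mixin_compat2 z w (mkposreal _ Hd') Hw).
    simpl in E.
    replace (sqrt 2 * (d / sqrt 2)) with d in E by (field; lra).
    exact E.
Qed.

(** Division-free, so [w = z] needs no exclusion. With [K] the whole plane it is the complex
    derivative, so approximants and limits share one notion. *)
Definition within_diff (K : C -> Prop) (f : C -> C) (z l : C) : Prop :=
  forall eps : R, 0 < eps ->
  exists d : R, 0 < d /\ forall w : C, K w -> Cmod (w - z) < d ->
    Cmod (f w - f z - l * (w - z)) <= eps * Cmod (w - z).

Lemma filterlim_locally_Cmod (F : (C -> Prop) -> Prop) (HF : Filter F) (f : C -> C) (l : C) :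
  filterlim f F (locally (T := C_UniformSpace) l) <->
  forall eps : R, 0 < eps -> F (fun w => Cmod (f w - l) < eps).
Proof.
  split.
  - intros H eps He. apply (H (fun u => Cmod (u - l) < eps)).
    apply locally_Cmod. exists eps. now split.
  - intros H P HP. apply locally_Cmod in HP. destruct HP as [d [Hd HP]].
    unfold filtermap. generalize (H d Hd). apply filter_imp. intros w; apply HP.
Qed.

Lemma is_derive_within_iff (K : C -> Prop) (f : C -> C) (z l : C) :
  is_derive_within K f z l <-> within_diff K f z l.
Proof.
  unfold is_derive_within. rewrite filterlim_locally_Cmod by typeclasses eauto.
  assert (Q : forall w, w <> z ->
     Cmod (f w - f z - l * (w - z)) = Cmod ((f w - f z) / (w - z) - l) * Cmod (w - z)).
  { intros w Hw. rewrite <- Cmod_mult. apply (f_equal Cmod). field.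
    intros E. apply Hw. now apply Cminus_eq_0. }
  split.
  - intros H eps He. specialize (H eps He).
    unfold within, locally', within in H. apply locally_Cmod in H.
    destruct H as [d [Hd H]]. exists d. split; [exact Hd|].
    intros w Kw Hw.
    destruct (Ceq_dec w z) as [->|Hne].
    + replace (f z - f z - l * (z - z))%C with (RtoC 0) by ring.
      rewrite Cmod_0, Cmod_minus_self. lra.
    + rewrite Q by exact Hne. apply Rmult_le_compat_r; [apply Cmod_ge_0|].
      left. apply H; auto.
  - intros H eps He. destruct (H (eps/2)) as [d [Hd H']]; [lra|].
    unfold within, locally', within. apply locally_Cmod. exists d. split; [exact Hd|].
    intros w Hw Hne Kw. specialize (H' w Kw Hw). rewrite Q in H' by exact Hne.
    assert (P : 0 < Cmod (w - z)).
    { apply Cmod_gt_0. intros E. apply Hne. now apply Cminus_eq_0. }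
    apply Rmult_le_reg_r in H'; [lra|exact P].
Qed.

Lemma is_derive_within_diff (f : C -> C) (z l : C) :
  is_derive (K := C_AbsRing) (V := C_NormedModule) f z l <->
  within_diff (fun _ => True) f z l.
Proof.
  split.
  - intros [_ H] eps He.
    assert (HL : is_filter_lim (locally (T := AbsRing_UniformSpace C_AbsRing) z) z) by (intros P HP; exact HP).
    specialize (H z HL (mkposreal eps He)). 
    (* [is_derive] uses the neighbourhoods of the absolute value, [locally_Cmod] those of the
       product structure; [locally_C] identifies them. *)
    assert (H2 := proj2 (locally_C z _) H). apply locally_Cmod in H2.
    destruct H2 as [d [Hd H2]]. exists d. split; [exact Hd|].
    intros w _ Hw. specialize (H2 w Hw). simpl in H2.
    change (Cmod (minus (minus (f w) (f z)) (Cmult (w - z) l)) <= eps * Cmod (w - z)) in H2.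
    replace (f w - f z - l * (w - z))%C with (minus (minus (f w) (f z)) ((w - z) * l)%C);
      [exact H2|].
    unfold minus, plus, opp; simpl. ring.
  - intros H. split.
    + apply (is_linear_scal_l (K := C_AbsRing) (V := C_NormedModule)).
    + intros x Hx.
      assert (E : x = z) by (symmetry; apply (is_filter_lim_locally_unique (K := C_AbsRing) (V := AbsRing_NormedModule C_AbsRing)); exact Hx).
      subst x. intros eps. apply (proj1 (locally_C z _)). apply locally_Cmod.
      destruct (H eps (cond_pos eps)) as [d [Hd H']]. exists d. split; [exact Hd|].
      intros w Hw. specialize (H' w I Hw).
      change (Cmod (minus (minus (f w) (f z)) (Cmult (w - z) l)) <= eps * Cmod (w - z)).
      replace (minus (minus (f w) (f z)) ((w - z) * l)%C) with (f w - f z - l * (w - z))%C;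
        [exact H'|].
      unfold minus, plus, opp; simpl. ring.
Qed.

Definition within_cont (K : C -> Prop) (f : C -> C) (z : C) : Prop :=
  forall eps : R, 0 < eps ->
  exists d : R, 0 < d /\ forall w : C, K w -> Cmod (w - z) < d -> Cmod (f w - f z) < eps.

Lemma within_diff_cont (K : C -> Prop) (f : C -> C) (z l : C) :
  within_diff K f z l -> within_cont K f z.
Proof.
  intros H eps He. destruct (H 1 Rlt_0_1) as [d [Hd H']].
  assert (Hl := Cmod_ge_0 l).
  assert (He' : 0 < eps / (Cmod l + 1)) by (apply Rdiv_lt_0_compat; lra).
  exists (Rmin d (eps / (Cmod l + 1))). split; [apply Rmin_glb_lt; assumption|].
  intros w Kw Hw.
  assert (Hw1 := Rlt_le_trans _ _ _ Hw (Rmin_l _ _)).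
  assert (Hw2 := Rlt_le_trans _ _ _ Hw (Rmin_r _ _)).
  specialize (H' w Kw Hw1).
  replace (f w - f z)%C with ((f w - f z - l * (w - z)) + l * (w - z))%C by ring.
  eapply Rle_lt_trans; [apply Cmod_triangle|]. rewrite Cmod_mult.
  apply (Rmult_lt_compat_r (Cmod l + 1)) in Hw2; [|lra].
  replace (eps / (Cmod l + 1) * (Cmod l + 1)) with eps in Hw2 by (field; lra).
  lra.
Qed.

Lemma continuous_on_within_cont (K : C -> Prop) (f : C -> C) :
  continuous_on (T := C_UniformSpace) (U := C_UniformSpace) K f <->
  forall z, K z -> within_cont K f z.
Proof.
  assert (E : forall z, filterlim f (within K (locally (T := C_UniformSpace) z))
                 (locally (T := C_UniformSpace) (f z)) <-> within_cont K f z).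
  { intros z. rewrite filterlim_locally_Cmod by typeclasses eauto.
    split.
    - intros H eps He. specialize (H eps He). apply locally_Cmod in H.
      destruct H as [d [Hd H]]. exists d. split; [exact Hd|]. intros w Kw Hw. now apply H.
    - intros H eps He. apply locally_Cmod. destruct (H eps He) as [d [Hd H']].
      exists d. split; [exact Hd|]. intros w Hw Kw. now apply H'. }
  split; intros H z Kz; apply E; exact (H z Kz).
Qed.

(** * Curves and the mean value inequality *)

Definition curve_diff (u : R -> C) (t : R) (l : C) : Prop :=
  forall eps : R, 0 < eps ->
  exists d : R, 0 < d /\ forall s : R, Rabs (s - t) < d ->
    Cmod (u s - u t - l * RtoC (s - t)) <= eps * Rabs (s - t).

Lemma is_derive_of_increments (f : R -> R) (t l : R) :
  (forall eps, 0 < eps -> exists d, 0 < d /\ forall s, Rabs (s - t) < d ->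
     Rabs (f s - f t - l * (s - t)) <= eps * Rabs (s - t)) ->
  is_derive f t l.
Proof.
  intros H. apply is_derive_Reals. intros eps He.
  destruct (H (eps / 2)) as [d [Hd H']]; [lra|].
  exists (mkposreal d Hd). intros h Hh0 Hh. simpl in Hh.
  specialize (H' (t + h)). replace (t + h - t) with h in H' by ring.
  specialize (H' Hh).
  replace ((f (t + h) - f t) / h - l) with ((f (t + h) - f t - l * h) / h) by (field; exact Hh0).
  assert (P := Rabs_pos_lt _ Hh0).
  rewrite Rabs_div by exact Hh0.
  apply (Rmult_lt_reg_r (Rabs h)); [exact P|].
  replace (Rabs (f (t + h) - f t - l * h) / Rabs h * Rabs h)
    with (Rabs (f (t + h) - f t - l * h)) by (field; lra).
  assert (0 < eps * Rabs h) by (apply Rmult_lt_0_compat; assumption).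
  lra.
Qed.

Lemma increments_of_is_derive (f : R -> R) (t l : R) :
  is_derive f t l ->
  forall eps, 0 < eps -> exists d, 0 < d /\ forall s, Rabs (s - t) < d ->
     Rabs (f s - f t - l * (s - t)) <= eps * Rabs (s - t).
Proof.
  intros H eps He. apply is_derive_Reals in H. destruct (H eps He) as [d H'].
  exists d. split; [apply cond_pos|]. intros s Hs.
  destruct (Req_dec (s - t) 0) as [E|Hne].
  - replace s with t by lra. replace (f t - f t - l * (t - t)) with 0 by ring.
    replace (t - t) with 0 by ring. rewrite Rabs_R0. lra.
  - specialize (H' (s - t) Hne Hs). replace (t + (s - t)) with s in H' by ring.
    replace (f s - f t - l * (s - t)) with (((f s - f t) / (s - t) - l) * (s - t))
      by (field; exact Hne).
    rewrite Rabs_mult. apply Rmult_le_compat_r; [apply Rabs_pos|lra].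
Qed.

Lemma curve_diff_components (u : R -> C) (t : R) (l : C) :
  curve_diff u t l <->
  is_derive (fun s => fst (u s)) t (fst l) /\ is_derive (fun s => snd (u s)) t (snd l).
Proof.
  assert (E1 : forall s, fst (u s - u t - l * RtoC (s - t))%C =
                fst (u s) - fst (u t) - fst l * (s - t)) by (intros; simpl; ring).
  assert (E2 : forall s, snd (u s - u t - l * RtoC (s - t))%C =
                snd (u s) - snd (u t) - snd l * (s - t)) by (intros; simpl; ring).
  split.
  - intros H. split; apply is_derive_of_increments; intros eps He;
    destruct (H eps He) as [d [Hd H']]; exists d; (split; [exact Hd|]); intros s Hs;
    eapply Rle_trans; [|exact (H' s Hs)| |exact (H' s Hs)];
    eapply Rle_trans; [|apply Rmax_Cmod| |apply Rmax_Cmod].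
    + rewrite <- E1. apply Rmax_l.
    + rewrite <- E2. apply Rmax_r.
  - intros [H1 H2] eps He.
    destruct (increments_of_is_derive _ _ _ H1 (eps / 2)) as [d1 [Hd1 H1']]; [lra|].
    destruct (increments_of_is_derive _ _ _ H2 (eps / 2)) as [d2 [Hd2 H2']]; [lra|].
    exists (Rmin d1 d2). split; [now apply Rmin_glb_lt|]. intros s Hs.
    specialize (H1' s (Rlt_le_trans _ _ _ Hs (Rmin_l _ _))).
    specialize (H2' s (Rlt_le_trans _ _ _ Hs (Rmin_r _ _))).
    eapply Rle_trans; [apply Cmod_le_abs|]. rewrite E1, E2. lra.
Qed.

(** Chain rule: differentiability of [phi] within [K] suffices because the curve stays in [K]. *)
Lemma curve_diff_comp (K : C -> Prop) (phi : C -> C) (gam : R -> C) (t : R) (l m : C) :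
  (forall s, K (gam s)) -> within_diff K phi (gam t) l -> curve_diff gam t m ->
  curve_diff (fun s => phi (gam s)) t (l * m).
Proof.
  intros HK Hphi Hgam eps He.
  assert (Hl := Cmod_ge_0 l). assert (Hm := Cmod_ge_0 m).
  destruct (Hphi (eps / (2 * (Cmod m + 1)))) as [d1 [Hd1 H1]];
    [apply Rdiv_lt_0_compat; lra|].
  (* The cap 1 makes [gam] locally Lipschitz at [t] with constant [Cmod m + 1]; the other bound
     keeps [l] times the remainder of [gam] below half of [eps]. *)
  set (e2 := Rmin 1 (eps / (2 * (Cmod l + 1)))).
  assert (He2 : 0 < e2).
  { apply Rmin_glb_lt; [lra|apply Rdiv_lt_0_compat; lra]. }
  assert (He21 : e2 <= 1) by apply Rmin_l.
  assert (He22 : e2 * Cmod l <= eps / 2).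
  { apply Rle_trans with (eps / (2 * (Cmod l + 1)) * (Cmod l + 1)).
    - apply Rmult_le_compat; try lra. apply Rmin_r.
    - right. field. lra. }
  destruct (Hgam e2 He2) as [d2 [Hd2 H2]].
  assert (Hd3 : 0 < d1 / (Cmod m + 1)) by (apply Rdiv_lt_0_compat; lra).
  exists (Rmin d2 (d1 / (Cmod m + 1))). split; [now apply Rmin_glb_lt|].
  intros s Hs.
  specialize (H2 s (Rlt_le_trans _ _ _ Hs (Rmin_l _ _))).
  assert (Hs2 := Rlt_le_trans _ _ _ Hs (Rmin_r _ _)).
  assert (Ha := Rabs_pos (s - t)).
  assert (Hg : Cmod (gam s - gam t) <= (Cmod m + 1) * Rabs (s - t)).
  { replace (gam s - gam t)%C with
      ((gam s - gam t - m * RtoC (s - t)) + m * RtoC (s - t))%C by ring.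
    eapply Rle_trans; [apply Cmod_triangle|]. rewrite Cmod_mult, Cmod_R. nra. }
  assert (Hg1 : Cmod (gam s - gam t) < d1).
  { apply (Rmult_lt_compat_l (Cmod m + 1)) in Hs2; [|lra].
    replace ((Cmod m + 1) * (d1 / (Cmod m + 1))) with d1 in Hs2 by (field; lra). lra. }
  specialize (H1 _ (HK s) Hg1).
  replace (phi (gam s) - phi (gam t) - l * m * RtoC (s - t))%C with
    ((phi (gam s) - phi (gam t) - l * (gam s - gam t)) +
     l * (gam s - gam t - m * RtoC (s - t)))%C by ring.
  eapply Rle_trans; [apply Cmod_triangle|]. rewrite Cmod_mult.
  apply Rle_trans with (eps / 2 * Rabs (s - t) + eps / 2 * Rabs (s - t)); [|lra].
  apply Rplus_le_compat.
  - eapply Rle_trans; [exact H1|].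
    apply Rle_trans with (eps / (2 * (Cmod m + 1)) * ((Cmod m + 1) * Rabs (s - t))).
    + apply Rmult_le_compat_l; [|exact Hg]. left. apply Rdiv_lt_0_compat; lra.
    + right. field. lra.
  - apply Rle_trans with (Cmod l * (e2 * Rabs (s - t))).
    + now apply Rmult_le_compat_l.
    + replace (Cmod l * (e2 * Rabs (s - t))) with ((e2 * Cmod l) * Rabs (s - t)) by ring.
      apply Rmult_le_compat_r; lra.
Qed.

(** The mean value theorem is real-valued, so it is applied to the real and imaginary parts
    separately; this is the origin of the factor 2. Derivatives are asked only inside the interval
    because the segment's paths have corners at 0 and 1. *)
Lemma curve_increment (u du : R -> C) (M : R) :
  (forall t, 0 < t < 1 -> curve_diff u t (du t)) ->
  (forall t, 0 <= t <= 1 -> forall eps, 0 < eps ->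
     exists d, 0 < d /\ forall s, Rabs (s - t) < d -> Cmod (u s - u t) < eps) ->
  (forall t, 0 <= t <= 1 -> Cmod (du t) <= M) ->
  Cmod (u 1 - u 0) <= 2 * M.
Proof.
  intros Hd Hc Hb.
  assert (G : forall p : C -> R,
    (forall a b, p (a - b)%C = p a - p b) ->
    (forall a, Rabs (p a) <= Cmod a) ->
    (forall t, 0 < t < 1 -> is_derive (fun s => p (u s)) t (p (du t))) ->
    Rabs (p (u 1 - u 0)%C) <= M).
  { intros p Hp1 Hp2 Hp3.
    destruct (MVT_gen (fun s => p (u s)) 0 1 (fun t => p (du t))) as [c [Hc1 Hc2]].
    - rewrite Rmin_left, Rmax_right by lra. exact Hp3.
    - rewrite Rmin_left, Rmax_right by lra. intros t Ht eps He.
      destruct (Hc t Ht eps He) as [d [Hd0 Hd1]]. exists d. split; [exact Hd0|].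
      intros s [_ Hs]. simpl. unfold Rdist. rewrite <- Hp1.
      eapply Rle_lt_trans; [apply Hp2|]. apply Hd1. exact Hs.
    - rewrite Rmin_left, Rmax_right in Hc1 by lra.
      rewrite Hp1, Hc2. rewrite Rmult_minus_distr_l, Rmult_1_r, Rmult_0_r, Rminus_0_r.
      eapply Rle_trans; [apply Hp2|]. now apply Hb. }
  eapply Rle_trans; [apply Cmod_le_abs|].
  replace (2 * M) with (M + M) by ring.
  apply Rplus_le_compat.
  - apply (G fst).
    + intros; reflexivity.
    + intros a. eapply Rle_trans; [|apply Rmax_Cmod]. apply Rmax_l.
    + intros t Ht. apply (curve_diff_components u t (du t)). now apply Hd.
  - apply (G snd).
    + intros; reflexivity.
    + intros a. eapply Rle_trans; [|apply Rmax_Cmod]. apply Rmax_r.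
    + intros t Ht. apply (curve_diff_components u t (du t)). now apply Hd.
Qed.

(** Quasiconvexity of [K] with constant [L]. The separate Lipschitz clause gives continuity at the
    end points and keeps the path within [L * Cmod (w - z)] of [z]. *)
Definition path_bound (K : C -> Prop) (L : R) : Prop :=
  forall z w : C, K z -> K w ->
  exists gam dgam : R -> C,
    gam 0 = z /\ gam 1 = w /\ (forall t, K (gam t)) /\
    (forall s t, Cmod (gam s - gam t) <= L * Cmod (w - z) * Rabs (s - t)) /\
    (forall t, 0 < t < 1 -> curve_diff gam t (dgam t)) /\
    (forall t, Cmod (dgam t) <= L * Cmod (w - z)).

(** The derivative is bounded only where the path can reach; this localisation is what makes Taylor
    estimates near [z] possible. *)
Lemma mean_value_inequality (K : C -> Prop) (L : R) (phi dphi : C -> C) (M : R) (z w : C) :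
  path_bound K L -> 0 <= L -> K z -> K w ->
  (forall v, K v -> within_diff K phi v (dphi v)) ->
  (forall v, K v -> Cmod (v - z) <= L * Cmod (w - z) -> Cmod (dphi v) <= M) ->
  Cmod (phi w - phi z) <= 2 * L * M * Cmod (w - z).
Proof.
  intros HP HL Kz Kw Hd HM.
  destruct (HP z w Kz Kw) as [gam [dgam [E0 [E1 [HK [Hlip [Hdg Hb]]]]]]].
  assert (Hwz := Cmod_ge_0 (w - z)).
  assert (HB : 0 <= L * Cmod (w - z)) by (apply Rmult_le_pos; lra).
  rewrite <- E1 at 1. rewrite <- E0 at 1.
  replace (2 * L * M * Cmod (w - z)) with (2 * (M * (L * Cmod (w - z)))) by ring.
  apply (curve_increment (fun t => phi (gam t)) (fun t => dphi (gam t) * dgam t)%C).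
  - intros t Ht. apply (curve_diff_comp K); auto.
  - intros t Ht eps He.
    destruct (within_diff_cont _ _ _ _ (Hd _ (HK t)) eps He) as [d [Hd0 Hd1]].
    assert (Hd2 : 0 < d / (L * Cmod (w - z) + 1)) by (apply Rdiv_lt_0_compat; lra).
    exists (d / (L * Cmod (w - z) + 1)). split; [exact Hd2|].
    intros s Hs. apply Hd1; [apply HK|].
    eapply Rle_lt_trans; [apply Hlip|].
    apply (Rmult_lt_compat_l (L * Cmod (w - z) + 1)) in Hs; [|lra].
    replace ((L * Cmod (w - z) + 1) * (d / (L * Cmod (w - z) + 1))) with d in Hs
      by (field; lra).
    assert (Ha := Rabs_pos (s - t)). lra.
  - intros t Ht. rewrite Cmod_mult.
    apply Rmult_le_compat; try apply Cmod_ge_0; [|apply Hb].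
    apply HM; [apply HK|]. rewrite <- E0 at 1.
    eapply Rle_trans; [apply Hlip|].
    rewrite Rminus_0_r, Rabs_pos_eq by lra.
    rewrite <- (Rmult_1_r (L * Cmod (w - z))) at 2. apply Rmult_le_compat_l; lra.
Qed.

(** * Limits of derivatives *)

Lemma sup_dist_lt (K : C -> Prop) (f g : C -> C) (eps : R) (z : C) :
  Rbar_lt (sup_dist K f g) eps -> K z -> Cmod (f z - g z) < eps.
Proof.
  intros H Kz.
  destruct (Lub_Rbar_correct (fun x : R => exists z : C, K z /\ x = Cmod (f z - g z)%C)) as [Hub _].
  change (Rbar_lt (Finite (Cmod (f z - g z))) eps).
  eapply Rbar_le_lt_trans; [|exact H]. apply Hub. now exists z.
Qed.

Lemma sup_dist_le (K : C -> Prop) (f g : C -> C) (M : R) :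
  (forall z, K z -> Cmod (f z - g z) <= M) -> Rbar_le (sup_dist K f g) M.
Proof.
  intros H.
  destruct (Lub_Rbar_correct (fun x : R => exists z : C, K z /\ x = Cmod (f z - g z)%C)) as [_ Hl].
  apply Hl. intros x [z [Kz ->]]. simpl. now apply H.
Qed.

Lemma within_diff_mono (K K' : C -> Prop) (f : C -> C) (z l : C) :
  (forall w, K w -> K' w) -> within_diff K' f z l -> within_diff K f z l.
Proof.
  intros HK H eps He. destruct (H eps He) as [d [Hd H']].
  exists d. split; [exact Hd|]. intros w Kw. apply H'. now apply HK.
Qed.

Lemma within_diff_minus_linear (K : C -> Prop) (f : C -> C) (z l a : C) :
  within_diff K f z l -> within_diff K (fun w => f w - a * w)%C z (l - a).
Proof.
  intros H eps He. destruct (H eps He) as [d [Hd H']].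
  exists d. split; [exact Hd|]. intros w Kw Hw.
  replace (f w - a * w - (f z - a * z) - (l - a) * (w - z))%C
    with (f w - f z - l * (w - z))%C by ring.
  now apply H'.
Qed.

Lemma Rle_of_le_plus_mult (x y c : R) :
  (forall eta, 0 < eta -> x <= y + eta * c) -> x <= y.
Proof.
  intros H. apply Rnot_lt_le. intros Hlt.
  assert (Hc := Rabs_pos c).
  assert (Hc' := Rle_abs c).
  assert (He : 0 < (x - y) / (2 * (Rabs c + 1))) by (apply Rdiv_lt_0_compat; lra).
  specialize (H _ He).
  assert (E : (x - y) / (2 * (Rabs c + 1)) * (Rabs c + 1) = (x - y) / 2) by (field; lra).
  nra.
Qed.

(* The first-order Taylor estimate for [F n k] on [K] is uniform in [n], so it survives the limit. *)
Lemma B_space_Cinfty (K : C -> Prop) (L : R) (g : nat -> C -> C) :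
  path_bound K L -> 0 <= L -> B_space K g -> Cinfty_space K g.
Proof.
  intros HP HL [HA [f [F [HO Hcv]]]].
  exists (g O). split; [reflexivity|].
  intros k z Kz. apply is_derive_within_iff. intros eps He.
  assert (Hcont : within_cont K (g (S k)) z).
  { destruct (HA (S k)) as [Hc _]. rewrite continuous_on_within_cont in Hc. now apply Hc. }
  (* The mean value inequality multiplies the oscillation of [g (S k)] by [2 * L]. The radius is
     later divided by [L + 1] because the path may stray to distance [L * Cmod (w - z)]. *)
  assert (He' : 0 < eps / (2 * L + 1)) by (apply Rdiv_lt_0_compat; lra).
  destruct (Hcont _ He') as [d [Hd Hd']].
  assert (Hd2 : 0 < d / (L + 1)) by (apply Rdiv_lt_0_compat; lra).
  exists (d / (L + 1)). split; [exact Hd2|].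
  intros w Kw Hw. assert (Hwz := Cmod_ge_0 (w - z)).
  assert (Hsmall : L * Cmod (w - z) < d).
  { apply (Rmult_lt_compat_l (L + 1)) in Hw; [|lra].
    replace ((L + 1) * (d / (L + 1))) with d in Hw by (field; lra). lra. }
  (* The summands are the errors of the values at [w] and [z], of the slope at [z], and of the
     derivative along the path. The radius was fixed before [eta], so [eta] may tend to 0. *)
  apply Rle_of_le_plus_mult with (c := 2 + Cmod (w - z) + 2 * L * 2 * Cmod (w - z)).
  intros eta Heta.
  destruct (Hcv k (mkposreal eta Heta)) as [N1 HN1].
  destruct (Hcv (S k) (mkposreal eta Heta)) as [N2 HN2].
  pose (n := Nat.max N1 N2).
  assert (A : forall v, K v -> Cmod (F n k v - g k v) < eta).
  { intros v Kv. apply (sup_dist_lt K); [|exact Kv]. apply HN1. apply Nat.le_max_l. }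
  assert (B : forall v, K v -> Cmod (F n (S k) v - g (S k) v) < eta).
  { intros v Kv. apply (sup_dist_lt K); [|exact Kv]. apply HN2. apply Nat.le_max_r. }
  clearbody n.
  destruct (HO n) as [V [_ [HKV [_ [_ HV]]]]].
  (* After subtracting the tangent at [z], the derivative is [F n (S k) v - F n (S k) z], which is
     small near [z] by comparison with the continuous [g (S k)]. *)
  assert (T : Cmod ((F n k w - F n (S k) z * w) - (F n k z - F n (S k) z * z))
              <= 2 * L * (eps / (2 * L + 1) + 2 * eta) * Cmod (w - z)).
  { apply (mean_value_inequality K L (fun v => F n k v - F n (S k) z * v)%C
             (fun v => F n (S k) v - F n (S k) z)%C); auto.
    - intros v Kv. apply within_diff_minus_linear.
      apply (within_diff_mono K (fun _ => True)); [easy|].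
      apply is_derive_within_diff. apply HV. now apply HKV.
    - intros v Kv Hv.
      eapply Rle_trans; [apply (Cmod_minus_triangle _ (g (S k) v))|].
      assert (B1 := B v Kv). assert (B2 := B z Kz). rewrite Cmod_minus_sym in B2.
      assert (B3 := Cmod_minus_triangle (g (S k) v) (g (S k) z) (F n (S k) z)).
      assert (B4 : Cmod (v - z) < d) by lra.
      assert (B5 := Hd' v Kv B4). lra. }
  replace (g k w - g k z - g (S k) z * (w - z))%C with
    ((g k w - F n k w) + (F n k z - g k z) + (F n (S k) z - g (S k) z) * (w - z)
     + ((F n k w - F n (S k) z * w) - (F n k z - F n (S k) z * z)))%C by ring.
  assert (A1 := A w Kw). assert (A2 := A z Kz). assert (B1 := B z Kz).
  rewrite Cmod_minus_sym in A1.
  eapply Rle_trans; [apply Cmod_triangle|].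
  eapply Rle_trans; [apply Rplus_le_compat_r; apply Cmod_triangle|].
  eapply Rle_trans; [apply Rplus_le_compat_r, Rplus_le_compat_r; apply Cmod_triangle|].
  rewrite Cmod_mult.
  assert (Q : Cmod (F n (S k) z - g (S k) z) * Cmod (w - z) <= eta * Cmod (w - z))
    by (apply Rmult_le_compat_r; lra).
  assert (E : 2 * L * (eps / (2 * L + 1)) <= eps).
  { apply Rle_trans with ((2 * L + 1) * (eps / (2 * L + 1))).
    - apply Rmult_le_compat_r; lra.
    - right. field. lra. }
  assert (E' : 2 * L * (eps / (2 * L + 1)) * Cmod (w - z) <= eps * Cmod (w - z))
    by (apply Rmult_le_compat_r; lra).
  lra.
Qed.

(** An empty interior makes the holomorphy clause vacuous; continuity follows from
    differentiability. *)
Lemma Cinfty_A_space (K : C -> Prop) (g : nat -> C -> C) :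
  (forall z, ~ Defs.interior K z) -> Cinfty_space K g -> forall k, A_space K (g k).
Proof.
  intros Hint [f [_ Hg]] k. split.
  - apply continuous_on_within_cont. intros z Kz.
    apply within_diff_cont with (g (S k) z). apply is_derive_within_iff. now apply Hg.
  - intros z Hz. now destruct (Hint z).
Qed.

(** * Laurent polynomials *)

Lemma within_diff_plus (f g : C -> C) (z l m : C) :
  within_diff (fun _ => True) f z l -> within_diff (fun _ => True) g z m ->
  within_diff (fun _ => True) (fun w => f w + g w)%C z (l + m).
Proof.
  intros Hf Hg. apply is_derive_within_diff.
  apply (is_derive_plus (K := C_AbsRing) (V := C_NormedModule)); now apply is_derive_within_diff.
Qed.

Lemma within_diff_mult (f g : C -> C) (z l m : C) :
  within_diff (fun _ => True) f z l -> within_diff (fun _ => True) g z m ->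
  within_diff (fun _ => True) (fun w => f w * g w)%C z (l * g z + f z * m).
Proof.
  (* The product rule is stated for [C] as a module over itself, a different structure from
     [C_NormedModule]; the limit clauses of the two derivatives coincide. *)
  assert (E : forall (h : C -> C) (n : C),
    is_derive (K := C_AbsRing) (V := AbsRing_NormedModule C_AbsRing) h z n <->
    within_diff (fun _ => True) h z n).
  { intros h n. rewrite <- is_derive_within_diff.
    split; intros [_ H]; (split; [apply is_linear_scal_l|exact H]). }
  rewrite <- !E. intros Hf Hg.
  exact (is_derive_mult (K := C_AbsRing) f g z l m Hf Hg Cmult_comm).
Qed.

Lemma within_diff_const (a z : C) : within_diff (fun _ => True) (fun _ => a) z 0.
Proof.
  intros eps He. exists 1. split; [lra|]. intros w _ _.
  replace (a - a - 0 * (w - z))%C with (RtoC 0) by ring. rewrite Cmod_0.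
  apply Rmult_le_pos; [lra|apply Cmod_ge_0].
Qed.

Lemma within_diff_id (z : C) : within_diff (fun _ => True) (fun w => w) z 1.
Proof.
  intros eps He. exists 1. split; [lra|]. intros w _ _.
  replace (w - z - 1 * (w - z))%C with (RtoC 0) by ring. rewrite Cmod_0.
  apply Rmult_le_pos; [lra|apply Cmod_ge_0].
Qed.

Lemma within_diff_inv (z : C) :
  z <> 0 -> within_diff (fun _ => True) Cinv z (- / (z * z)).
Proof.
  intros Hz eps He.
  assert (Pz := proj1 (Cmod_gt_0 z) Hz). set (r := Cmod z) in *.
  assert (P3 : 0 < r * r * r) by (repeat apply Rmult_lt_0_compat; exact Pz).
  (* The first bound keeps [Cmod w] above [r / 2]; the second then makes the exact remainder
     [(w - z)^2 / (w z^2)] at most [eps * Cmod (w - z)]. *)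
  exists (Rmin (r / 2) (eps * (r * r * r) / 2)). split.
  { apply Rmin_glb_lt; [lra|]. apply Rdiv_lt_0_compat; [|lra].
    now apply Rmult_lt_0_compat. }
  intros w _ Hw.
  assert (H1 := Rlt_le_trans _ _ _ Hw (Rmin_l _ _)).
  assert (H2 := Rlt_le_trans _ _ _ Hw (Rmin_r _ _)). clear Hw.
  assert (Hrw : r / 2 <= Cmod w).
  { assert (T := Cmod_triangle w (z - w)). replace (w + (z - w))%C with z in T by ring.
    fold r in T. rewrite (Cmod_minus_sym z w) in T. lra. }
  assert (Hw0 : w <> 0). { apply Cmod_gt_0. lra. }
  replace (/ w - / z - - / (z * z) * (w - z))%C with ((w - z) * (w - z) / (w * z * z))%C
    by (field; split; assumption).
  rewrite Cmod_div by (repeat apply Cmult_neq_0; assumption).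
  rewrite !Cmod_mult. fold r.
  assert (Hn := Cmod_ge_0 (w - z)). set (x := Cmod (w - z)) in *. set (y := Cmod w) in *.
  assert (Py : 0 < y * r * r) by (repeat apply Rmult_lt_0_compat; lra).
  apply (Rmult_le_reg_r (y * r * r)); [exact Py|].
  replace (x * x / (y * r * r) * (y * r * r)) with (x * x) by (field; split; lra).
  assert (Q : eps * (r * r * r) / 2 <= eps * (y * r * r)).
  { replace (eps * (r * r * r) / 2) with (eps * (r / 2 * (r * r))) by field.
    replace (y * r * r) with (y * (r * r)) by ring.
    apply Rmult_le_compat_l; [lra|]. apply Rmult_le_compat_r; nra. }
  replace (eps * x * (y * r * r)) with (eps * (y * r * r) * x) by ring.
  apply Rmult_le_compat_r; lra.
Qed.

(** At least one of the two natural exponents is 0, so for [w <> 0] this is the integer power. *)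
Definition Czpow (w : C) (j : Z) : C := (w ^ Z.to_nat j * (/ w) ^ Z.to_nat (- j))%C.

Lemma Czpow_succ (w : C) (j : Z) : w <> 0 -> Czpow w (j + 1) = (w * Czpow w j)%C.
Proof.
  intros Hw. unfold Czpow. destruct (Z.le_gt_cases 0 j) as [H|H].
  - replace (Z.to_nat (j + 1)) with (S (Z.to_nat j)) by lia.
    replace (Z.to_nat (- (j + 1))) with (Z.to_nat (- j)) by lia.
    rewrite Cpow_S. ring.
  - replace (Z.to_nat (- j)) with (S (Z.to_nat (- (j + 1)))) by lia.
    replace (Z.to_nat (j + 1)) with (Z.to_nat j) by lia.
    rewrite Cpow_S. field. exact Hw.
Qed.

Lemma Czpow_pred (w : C) (j : Z) : w <> 0 -> Czpow w (j - 1) = (/ w * Czpow w j)%C.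
Proof.
  intros Hw. replace j with (j - 1 + 1)%Z at 2 by ring.
  rewrite (Czpow_succ w (j - 1)) by exact Hw. field. exact Hw.
Qed.

Lemma Czpow_0 (w : C) : Czpow w 0 = 1.
Proof. unfold Czpow. simpl. ring. Qed.

Lemma Czpow_1 (w : C) : Czpow w 1 = w.
Proof. unfold Czpow. simpl. ring. Qed.

Lemma Czpow_m1 (w : C) : Czpow w (-1) = (/ w)%C.
Proof. unfold Czpow. simpl. ring. Qed.

Lemma Czpow_add (w : C) (i j : Z) : w <> 0 -> Czpow w (i + j) = (Czpow w i * Czpow w j)%C.
Proof.
  intros Hw. revert i. apply Z.peano_ind.
  - rewrite Czpow_0. rewrite Z.add_0_l. ring.
  - intros i IH. replace (Z.succ i + j)%Z with (i + j + 1)%Z by lia.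
    replace (Z.succ i) with (i + 1)%Z by lia. rewrite !Czpow_succ, IH by exact Hw. ring.
  - intros i IH. replace (Z.pred i + j)%Z with (i + j - 1)%Z by lia.
    replace (Z.pred i) with (i - 1)%Z by lia. rewrite !Czpow_pred, IH by exact Hw. ring.
Qed.

Lemma within_diff_ext (K : C -> Prop) (f g : C -> C) (z l : C) (r : R) :
  0 < r -> (forall w, Cmod (w - z) < r -> f w = g w) ->
  within_diff K f z l -> within_diff K g z l.
Proof.
  intros Hr E H eps He. destruct (H eps He) as [d [Hd H']].
  exists (Rmin d r). split; [now apply Rmin_glb_lt|]. intros w Kw Hw.
  rewrite <- (E w), <- (E z).
  - apply H'; [exact Kw|]. eapply Rlt_le_trans; [exact Hw|apply Rmin_l].
  - now rewrite Cmod_minus_self.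
  - eapply Rlt_le_trans; [exact Hw|apply Rmin_r].
Qed.

Lemma Cmod_near_neq_0 (z w : C) : Cmod (w - z) < Cmod z -> w <> 0.
Proof.
  intros H ->. rewrite Cmod_minus_sym in H. replace (z - 0)%C with z in H by ring. lra.
Qed.

(** Product rule and induction on [j] in both directions. The recursions for powers require a
    nonzero argument, so they are used on the disc of radius [Cmod z] about [z]. *)
Lemma within_diff_Czpow (z : C) (j : Z) :
  z <> 0 -> within_diff (fun _ => True) (fun w => Czpow w j) z (RtoC (IZR j) * Czpow z (j - 1)).
Proof.
  intros Hz. assert (Pz := proj1 (Cmod_gt_0 z) Hz). revert j. apply Z.peano_ind.
  - apply within_diff_ext with (fun _ => RtoC 1) 1; [lra| |].
    + intros w _. symmetry. apply Czpow_0.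
    + replace (RtoC (IZR 0) * Czpow z (0 - 1))%C with (RtoC 0) by ring. apply within_diff_const.
  - intros j IH. apply within_diff_ext with (fun w => w * Czpow w j)%C (Cmod z); [exact Pz| |].
    + intros w Hw. symmetry. apply Czpow_succ. now apply (Cmod_near_neq_0 z).
    + replace (RtoC (IZR (Z.succ j)) * Czpow z (Z.succ j - 1))%C
        with (1 * Czpow z j + z * (RtoC (IZR j) * Czpow z (j - 1)))%C.
      * apply (within_diff_mult (fun w => w)); [apply within_diff_id|exact IH].
      * replace (Z.succ j - 1)%Z with j by lia. rewrite Czpow_pred by exact Hz.
        rewrite succ_IZR, RtoC_plus. field. exact Hz.
  - intros j IH. apply within_diff_ext with (fun w => / w * Czpow w j)%C (Cmod z); [exact Pz| |].
    + intros w Hw. symmetry. apply Czpow_pred. now apply (Cmod_near_neq_0 z).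
    + replace (RtoC (IZR (Z.pred j)) * Czpow z (Z.pred j - 1))%C
        with (- / (z * z) * Czpow z j + / z * (RtoC (IZR j) * Czpow z (j - 1)))%C.
      * apply (within_diff_mult Cinv); [now apply within_diff_inv|exact IH].
      * replace (Z.pred j - 1)%Z with (j - 1 - 1)%Z by lia. rewrite !Czpow_pred by exact Hz.
        replace (Z.pred j) with (j - 1)%Z by lia. rewrite minus_IZR, RtoC_minus.
        field. exact Hz.
Qed.

(* The list [(a_1, j_1), (a_2, j_2), ...] stands for the Laurent polynomial
   [sum_i a_i (z - c)^(j_i)]; exponents may repeat. *)
Fixpoint laurent (c : C) (l : list (C * Z)) (z : C) : C :=
  match l with
  | nil => 0
  | (a, j) :: l' => (a * Czpow (z - c) j + laurent c l' z)%C
  end.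

(** Vanishing terms are kept: exponent 0 yields [(a * 0, -1)]. Derivatives may thus leave the
    admissible exponents, but admissibility is only claimed for the list itself. *)
Definition laurent_deriv (l : list (C * Z)) : list (C * Z) :=
  map (fun p => ((fst p * RtoC (IZR (snd p)))%C, (snd p - 1)%Z)) l.

Definition laurent_derivs (k : nat) (l : list (C * Z)) : list (C * Z) :=
  Nat.iter k laurent_deriv l.

Lemma laurent_app (c : C) (l1 l2 : list (C * Z)) (z : C) :
  laurent c (l1 ++ l2) z = (laurent c l1 z + laurent c l2 z)%C.
Proof. induction l1 as [|[a j] l1 IH]; simpl; [|rewrite IH]; ring. Qed.

Lemma laurent_derivs_app (k : nat) (l1 l2 : list (C * Z)) :
  laurent_derivs k (l1 ++ l2) = laurent_derivs k l1 ++ laurent_derivs k l2.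
Proof.
  induction k as [|k IH]; [reflexivity|]. unfold laurent_derivs in *. simpl. rewrite IH.
  apply map_app.
Qed.

(** Iteration puts the extra derivative outermost; cancelling a primitive needs it innermost. *)
Lemma laurent_derivs_succ (k : nat) (l : list (C * Z)) :
  laurent_derivs (S k) l = laurent_derivs k (laurent_deriv l).
Proof.
  unfold laurent_derivs. induction k as [|k IH]; [reflexivity|]. simpl in *. now rewrite IH.
Qed.

Lemma within_diff_laurent (c : C) (l : list (C * Z)) (z : C) :
  z <> c ->
  within_diff (fun _ => True) (laurent c l) z (laurent c (laurent_deriv l) z).
Proof.
  intros Hz. assert (Hzc : (z - c)%C <> 0) by (intros E; apply Hz; now apply Cminus_eq_0).
  induction l as [|[a j] l IH]; [apply within_diff_const|].
  simpl. apply within_diff_plus; [|exact IH].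
  replace (a * RtoC (IZR j) * Czpow (z - c) (j - 1))%C with
    (0 * Czpow (z - c) j + a * (RtoC (IZR j) * Czpow (z - c) (j - 1)))%C by ring.
  apply (within_diff_mult (fun _ => a) (fun w => Czpow (w - c) j)); [apply within_diff_const|].
  intros eps He. destruct (within_diff_Czpow _ j Hzc eps He) as [d [Hd H]].
  exists d. split; [exact Hd|]. intros w _ Hw.
  specialize (H (w - c)%C I). replace (w - c - (z - c))%C with (w - z)%C in H by ring.
  exact (H Hw).
Qed.

Fixpoint laurent_residue (l : list (C * Z)) : C :=
  match l with
  | nil => 0
  | (a, j) :: l' => if Z.eq_dec j (-1) then (a + laurent_residue l')%C else laurent_residue l'
  end.

Definition laurent_strip (l : list (C * Z)) : list (C * Z) :=
  filter (fun p => if Z.eq_dec (snd p) (-1) then false else true) l.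

Definition laurent_primitive (l : list (C * Z)) : list (C * Z) :=
  map (fun p => ((fst p / RtoC (IZR (snd p + 1)))%C, (snd p + 1)%Z)) l.

(** Being an equality of lists, it carries over to all higher derivatives by rewriting. *)
Lemma laurent_deriv_primitive (l : list (C * Z)) :
  laurent_deriv (laurent_primitive (laurent_strip l)) = laurent_strip l.
Proof.
  induction l as [|[a j] l IH]; [reflexivity|]. simpl.
  destruct (Z.eq_dec j (-1)) as [E|E]; [exact IH|]. simpl. rewrite IH. f_equal. f_equal.
  - field. intros H. apply RtoC_inj in H. apply eq_IZR in H. lia.
  - lia.
Qed.

Lemma laurent_derivs_scal (c : C) (k : nat) (a b : C) (j : Z) (z : C) :
  laurent c (laurent_derivs k ((b * a, j)%C :: nil)) z =
  (b * laurent c (laurent_derivs k ((a, j) :: nil)) z)%C.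
Proof.
  revert a j. induction k as [|k IH]; intros a j.
  - simpl. ring.
  - rewrite !laurent_derivs_succ. simpl. rewrite <- Cmult_assoc. apply IH.
Qed.

Lemma laurent_derivs_cons (c : C) (k : nat) (a : C) (j : Z) (l : list (C * Z)) (z : C) :
  laurent c (laurent_derivs k ((a, j) :: l)) z =
  (laurent c (laurent_derivs k ((a, j) :: nil)) z + laurent c (laurent_derivs k l) z)%C.
Proof.
  change ((a, j) :: l) with (((a, j) :: nil) ++ l).
  now rewrite laurent_derivs_app, laurent_app.
Qed.

(** A single number, the residue, measures what stripping changes in every derivative at once. *)
Lemma laurent_derivs_strip (c : C) (k : nat) (l : list (C * Z)) (z : C) :
  laurent c (laurent_derivs k l) z =
  (laurent c (laurent_derivs k (laurent_strip l)) z +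
   laurent_residue l * laurent c (laurent_derivs k ((RtoC 1, (-1)%Z) :: nil)) z)%C.
Proof.
  induction l as [|[a j] l IH].
  - simpl. replace (laurent_derivs k nil) with (@nil (C * Z)).
    + simpl. ring.
    + symmetry. induction k as [|k IHk]; [reflexivity|]. now rewrite laurent_derivs_succ.
  - rewrite laurent_derivs_cons. simpl. destruct (Z.eq_dec j (-1)) as [->|E].
    + simpl. rewrite IH. rewrite <- (Cmult_1_r a) at 1. rewrite laurent_derivs_scal. ring.
    + simpl. rewrite (laurent_derivs_cons c k a j (laurent_strip l)), IH. ring.
Qed.

(** * Simultaneous approximation of derivatives *)

(** Stands in for compactness of [K] in the general argument. *)
Definition bounded_continuous (K : C -> Prop) : Prop :=
  forall phi : C -> C, (forall z, K z -> within_cont K phi z) ->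
  exists M : R, 0 <= M /\ forall z, K z -> Cmod (phi z) <= M.

(* In the next three definitions [adm] restricts the exponents: all of them for the circle,
   the nonnegative ones for a segment, where no residue may appear. *)
Definition admissible (adm : Z -> Prop) (l : list (C * Z)) : Prop :=
  Forall (fun p => adm (snd p)) l.

Definition residue_bound (K : C -> Prop) (c : C) (adm : Z -> Prop) (A : R) : Prop :=
  forall (l : list (C * Z)) (g dg : C -> C) (d : R),
    admissible adm l ->
    (forall z, K z -> within_diff K g z (dg z)) ->
    (forall z, K z -> Cmod (laurent c l z - dg z) <= d) ->
    Cmod (laurent_residue l) <= A * d.

Definition lipschitz_approximable (K : C -> Prop) (c : C) (adm : Z -> Prop) : Prop :=
  forall (h : C -> C) (Lam : R),
    (forall z w, K z -> K w -> Cmod (h w - h z) <= Lam * Cmod (w - z)) ->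
    forall eps, 0 < eps ->
    exists l, admissible adm l /\ forall z, K z -> Cmod (laurent c l z - h z) <= eps.

Lemma laurent_derivs_bounded (K : C -> Prop) (c : C) (l : list (C * Z)) (n : nat) :
  bounded_continuous K -> ~ K c ->
  exists B : R, 0 <= B /\ forall k z, (k <= n)%nat -> K z ->
    Cmod (laurent c (laurent_derivs k l) z) <= B.
Proof.
  intros HB Hc.
  assert (H : forall k, exists B : R, 0 <= B /\ forall z, K z ->
    Cmod (laurent c (laurent_derivs k l) z) <= B).
  { intros k. apply HB. intros z Kz.
    apply within_diff_cont with (laurent c (laurent_deriv (laurent_derivs k l)) z).
    apply (within_diff_mono K (fun _ => True)); [easy|].
    apply within_diff_laurent. intros ->. contradiction. }
  induction n as [|n IH].
  - destruct (H 0%nat) as [B [HB0 HB1]]. exists B. split; [exact HB0|].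
    intros k z Hk Kz. replace k with 0%nat by lia. now apply HB1.
  - destruct IH as [B [HB0 HB1]]. destruct (H (S n)) as [B' [HB0' HB1']].
    exists (Rmax B B'). split; [eapply Rle_trans; [exact HB0|apply Rmax_l]|].
    intros k z Hk Kz. destruct (Nat.eq_dec k (S n)) as [->|E].
    + eapply Rle_trans; [now apply HB1'|apply Rmax_r].
    + eapply Rle_trans; [apply HB1; [lia|exact Kz]|apply Rmax_l].
Qed.

Lemma within_diff_sub (K : C -> Prop) (f g : C -> C) (z l m : C) :
  within_diff K f z l -> within_diff K g z m ->
  within_diff K (fun w => f w - g w)%C z (l - m).
Proof.
  intros Hf Hg eps He.
  destruct (Hf (eps / 2)) as [d1 [Hd1 H1]]; [lra|].
  destruct (Hg (eps / 2)) as [d2 [Hd2 H2]]; [lra|].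
  exists (Rmin d1 d2). split; [now apply Rmin_glb_lt|]. intros w Kw Hw.
  specialize (H1 w Kw (Rlt_le_trans _ _ _ Hw (Rmin_l _ _))).
  specialize (H2 w Kw (Rlt_le_trans _ _ _ Hw (Rmin_r _ _))).
  replace (f w - g w - (f z - g z) - (l - m) * (w - z))%C
    with ((f w - f z - l * (w - z)) - (g w - g z - m * (w - z)))%C by ring.
  eapply Rle_trans; [apply Cmod_triangle|]. rewrite Cmod_opp. lra.
Qed.

(* Induction on [n]: approximate the derivatives [g 1, ..., g (n+1)], drop the small
   [(z - c)^(-1)] term, and take the primitive that is exact at one point. *)
Lemma laurent_approximation (K : C -> Prop) (L : R) (c z0 : C) (adm : Z -> Prop) (A : R) :
  path_bound K L -> 0 <= L -> K z0 -> ~ K c -> bounded_continuous K ->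
  residue_bound K c adm A -> 0 <= A -> lipschitz_approximable K c adm ->
  adm 0%Z -> (forall j, adm j -> adm (j + 1)%Z) ->
  forall (n : nat) (g : nat -> C -> C),
  (forall k z, K z -> within_diff K (g k) z (g (S k) z)) ->
  forall eps, 0 < eps ->
  exists l, admissible adm l /\ forall k z, (k <= n)%nat -> K z ->
    Cmod (laurent c (laurent_derivs k l) z - g k z) <= eps.
Proof.
  intros HP HL Kz0 Hc HB HR HA Happ adm0 admS n.
  (* [D] bounds the distance to the base point [z0], hence the cost of one integration. *)
  destruct (HB (fun w => w - z0)%C) as [D [HD0 HD]].
  { intros z Kz. intros eps He. exists eps. split; [exact He|]. intros w _ Hw.
    now replace (w - z0 - (z - z0))%C with (w - z)%C by ring. }
  induction n as [|n IH]; intros g Hg eps He.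
  - destruct (HB (g 1%nat)) as [M [HM0 HM]].
    { intros z Kz. apply within_diff_cont with (g 2%nat z). now apply Hg. }
    destruct (Happ (g O) (2 * L * M)) with (eps := eps) as [l [Hl1 Hl2]]; [|exact He|].
    { intros z w Kz Kw. apply (mean_value_inequality K L (g O) (g 1%nat)); auto. }
    exists l. split; [exact Hl1|]. intros k z Hk Kz. replace k with O by lia. now apply Hl2.
  - destruct (laurent_derivs_bounded K c ((RtoC 1, (-1)%Z) :: nil) n HB Hc) as [B [HB0 HB1]].
    assert (P1 : 0 < 1 + A * B) by nra. assert (P2 : 0 < 1 + 2 * L * D) by nra.
    (* Dropping the residue term turns an error [d] into at most [d * (1 + A * B)], and integrating
       from [z0] multiplies by [2 * L * D]. The 1 in the second factor serves the derivatives of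
       positive order, which are not integrated. *)
    set (d := eps / ((1 + A * B) * (1 + 2 * L * D))).
    assert (Hd : 0 < d).
    { apply Rdiv_lt_0_compat; [exact He|]. now apply Rmult_lt_0_compat. }
    assert (HE : d * (1 + A * B) * (1 + 2 * L * D) = eps) by (unfold d; field; lra).
    destruct (IH (fun k => g (S k))) with (eps := d) as [l [Hl1 Hl2]];
      [intros; now apply Hg|exact Hd|].
    set (E := d * (1 + A * B)) in *.
    assert (HE0 : 0 < E) by now apply Rmult_lt_0_compat.
    assert (Hr : Cmod (laurent_residue l) <= A * d).
    { apply (HR l (g O) (g 1%nat)); [exact Hl1|intros; now apply Hg|].
      intros z Kz. apply (Hl2 O z); [lia|exact Kz]. }
    assert (Hs : forall k z, (k <= n)%nat -> K z ->
      Cmod (laurent c (laurent_derivs k (laurent_strip l)) z - g (S k) z) <= E).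
    { intros k z Hk Kz. assert (S1 := Hl2 k z Hk Kz). rewrite laurent_derivs_strip in S1.
      set (x := laurent c (laurent_derivs k (laurent_strip l)) z) in *.
      assert (S2 := HB1 k z Hk Kz).
      set (y := laurent c (laurent_derivs k ((RtoC 1, (-1)%Z) :: nil)) z) in *.
      set (r := laurent_residue l) in *.
      replace (x - g (S k) z)%C with ((x + r * y - g (S k) z) - r * y)%C by ring.
      eapply Rle_trans; [apply Cmod_triangle|]. rewrite Cmod_opp, Cmod_mult.
      assert (Q : Cmod r * Cmod y <= A * d * B)
        by (apply Rmult_le_compat; try apply Cmod_ge_0; assumption).
      unfold E. lra. }
    set (P := laurent_primitive (laurent_strip l)).
    set (b := (g O z0 - laurent c P z0)%C).
    assert (Hder : forall k z, laurent c (laurent_derivs (S k) ((b, 0%Z) :: P)) z =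
       laurent c (laurent_derivs k (laurent_strip l)) z).
    { intros k z. rewrite laurent_derivs_succ. simpl.
      unfold P. rewrite laurent_deriv_primitive, laurent_derivs_cons.
      (* The integration constant leaves the term [(b * 0, -1)] behind; pulling out the scalar 0
         shows that its derivatives vanish. *)
      replace (b * 0)%C with (0 * 0)%C by ring. rewrite laurent_derivs_scal. ring. }
    exists ((b, 0%Z) :: P). split.
    { constructor; [exact adm0|]. unfold P, laurent_primitive. apply Forall_map.
      unfold laurent_strip. apply Forall_forall. intros p Hp. apply filter_In in Hp.
      simpl. apply admS. unfold admissible in Hl1. rewrite Forall_forall in Hl1. now apply Hl1. }
    intros k z Hk Kz. destruct k as [|k].
    + change (laurent_derivs 0 ((b, 0%Z) :: P)) with ((b, 0%Z) :: P).
      set (phi := fun w => (laurent c ((b, 0%Z) :: P) w - g O w)%C).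
      assert (H0 : phi z0 = 0).
      { unfold phi, b. simpl. rewrite Czpow_0. ring. }
      change (Cmod (phi z) <= eps). replace (phi z) with (phi z - phi z0)%C by (rewrite H0; ring).
      eapply Rle_trans.
      * apply (mean_value_inequality K L phi
          (fun w => laurent c (laurent_deriv ((b, 0%Z) :: P)) w - g 1%nat w)%C E z0 z); auto.
        -- intros v Kv. apply within_diff_sub; [|now apply Hg].
           apply (within_diff_mono K (fun _ => True)); [easy|].
           apply within_diff_laurent. intros ->. contradiction.
        -- intros v Kv _.
           change (laurent_deriv ((b, 0%Z) :: P)) with (laurent_derivs 1 ((b, 0%Z) :: P)).
           rewrite Hder. apply (Hs O v); [lia|exact Kv].
      * assert (HDz := HD z Kz). simpl in HDz.
        assert (Q : 2 * L * E * Cmod (z - z0) <= 2 * L * E * D)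
          by (apply Rmult_le_compat_l; [nra|exact HDz]).
        lra.
    + rewrite Hder. eapply Rle_trans; [apply Hs; [lia|exact Kz]|].
      assert (0 <= E * (2 * L * D)) by (apply Rmult_le_pos; [lra|nra]). lra.
Qed.

Lemma laurent_O_space (K : C -> Prop) (c : C) (l : list (C * Z)) :
  ~ K c -> O_space K (laurent c l) (fun k => laurent c (laurent_derivs k l)).
Proof.
  intros Hc. exists (fun z => z <> c).
  assert (D : forall k z, z <> c -> is_derive (K := C_AbsRing) (V := C_NormedModule)
    (laurent c (laurent_derivs k l)) z (laurent c (laurent_derivs (S k) l) z)).
  { intros k z Hz. apply is_derive_within_diff. now apply within_diff_laurent. }
  split; [|split; [|split; [|split; [reflexivity|exact D]]]].
  - intros z Hz. apply locally_Cmod. exists (Cmod (z - c)). split.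
    + apply Cmod_gt_0. intros E. apply Hz. now apply Cminus_eq_0.
    + intros w Hw ->. rewrite Cmod_minus_sym in Hw. lra.
  - intros z Kz ->. contradiction.
  - intros z Hz. exists (laurent c (laurent_derivs 1 l) z). exact (D O z Hz).
Qed.

(** Diagonal choice: the approximant of index [n] handles orders up to [n] with error [/ INR (S n)],
    so each fixed order [k] is controlled once [n >= k]. *)
Lemma Cinfty_B_space (K : C -> Prop) (L : R) (c z0 : C) (adm : Z -> Prop) (A : R) :
  (forall z, ~ Defs.interior K z) ->
  path_bound K L -> 0 <= L -> K z0 -> ~ K c -> bounded_continuous K ->
  residue_bound K c adm A -> 0 <= A -> lipschitz_approximable K c adm ->
  adm 0%Z -> (forall j, adm j -> adm (j + 1)%Z) ->
  forall g : nat -> C -> C, Cinfty_space K g -> B_space K g.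
Proof.
  intros Hint HP HL Kz0 Hc HB HR HA Happ adm0 admS g Hg.
  split; [now apply Cinfty_A_space|].
  assert (Hg' : forall k z, K z -> within_diff K (g k) z (g (S k) z)).
  { destruct Hg as [f [_ Hg]]. intros k z Kz. apply is_derive_within_iff. now apply Hg. }
  assert (Hn : forall n : nat, exists l, forall k z, (k <= n)%nat -> K z ->
    Cmod (laurent c (laurent_derivs k l) z - g k z) <= / INR (S n)).
  { intros n.
    destruct (laurent_approximation K L c z0 adm A HP HL Kz0 Hc HB HR HA Happ adm0 admS n g Hg'
      (/ INR (S n))) as [l [_ Hl]].
    - apply Rinv_0_lt_compat, lt_0_INR. lia.
    - now exists l. }
  pose (l := fun n => proj1_sig (constructive_indefinite_description _ (Hn n))).
  exists (fun n => laurent c (l n)), (fun n k => laurent c (laurent_derivs k (l n))). split.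
  - intros n. now apply laurent_O_space.
  - intros k eps. destruct (archimed_cor1 eps (cond_pos eps)) as [N [HN1 HN2]].
    exists (Nat.max N k). intros n Hn'.
    eapply Rbar_le_lt_trans.
    + apply (sup_dist_le _ _ _ (/ INR (S n))). intros z Kz. unfold l.
      destruct (constructive_indefinite_description _ (Hn n)) as [l' Hl']. simpl.
      apply Hl'; [lia|exact Kz].
    + change (/ INR (S n) < eps). eapply Rle_lt_trans; [|exact HN1].
      apply Rinv_le_contravar; [now apply lt_0_INR|apply le_INR; lia].
Qed.

(** * Bernstein polynomials *)

(* De Casteljau form of the Bernstein polynomial with values [phi 0, ..., phi n]: the
   recursion gives positivity and the second moment without binomial coefficients. *)
Fixpoint bernstein (n : nat) (t : C) (phi : nat -> C) : C :=
  match n with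
  | O => phi O
  | S n' => ((1 - t) * bernstein n' t phi + t * bernstein n' t (fun k => phi (S k)))%C
  end.

(** The same operator on real data, carrying the error majorants. *)
Fixpoint bernsteinR (n : nat) (t : R) (psi : nat -> R) : R :=
  match n with
  | O => psi O
  | S n' => (1 - t) * bernsteinR n' t psi + t * bernsteinR n' t (fun k => psi (S k))
  end.

(** For [0 <= t <= 1] each step is a convex combination, which preserves majorants of the distance
    to [v]. *)
Lemma bernstein_dist_le (n : nat) (t : R) (phi : nat -> C) (psi : nat -> R) (v : C) :
  0 <= t <= 1 -> (forall k, (k <= n)%nat -> Cmod (phi k - v) <= psi k) ->
  Cmod (bernstein n (RtoC t) phi - v) <= bernsteinR n t psi.
Proof.
  intros Ht. revert phi psi. induction n as [|n IH]; intros phi psi H; [now apply H|]. simpl.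
  assert (I1 : Cmod (bernstein n (RtoC t) phi - v) <= bernsteinR n t psi)
    by (apply IH; intros; apply H; lia).
  assert (I2 : Cmod (bernstein n (RtoC t) (fun k => phi (S k)) - v) <=
    bernsteinR n t (fun k => psi (S k))) by (apply IH; intros; apply H; lia).
  set (x := bernstein n (RtoC t) phi) in *.
  set (y := bernstein n (RtoC t) (fun k => phi (S k))) in *.
  replace ((1 - RtoC t) * x + RtoC t * y - v)%C with (RtoC (1 - t) * (x - v) + RtoC t * (y - v))%C
    by (rewrite RtoC_minus; ring).
  eapply Rle_trans; [apply Cmod_triangle|].
  rewrite !Cmod_mult, !Cmod_R, !Rabs_pos_eq by lra.
  apply Rplus_le_compat; apply Rmult_le_compat_l; lra.
Qed.

Lemma bernsteinR_ext (n : nat) (t : R) (psi1 psi2 : nat -> R) :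
  (forall k, psi1 k = psi2 k) -> bernsteinR n t psi1 = bernsteinR n t psi2.
Proof.
  revert psi1 psi2. induction n as [|n IH]; intros psi1 psi2 H; [apply H|]. simpl.
  rewrite (IH psi1 psi2 H). rewrite (IH (fun k => psi1 (S k)) (fun k => psi2 (S k))); [reflexivity|].
  intros k. apply H.
Qed.

(** Second moment of a shifted binomial variable. The free shift [s] makes the induction close:
    reindexing by [S k] replaces [s] by [1 + s]. *)
Lemma bernsteinR_second_moment (n : nat) (t A B s : R) :
  bernsteinR n t (fun k => A + B * (INR k + s) ^ 2) =
  A + B * ((INR n * t + s) ^ 2 + INR n * t * (1 - t)).
Proof.
  revert s. induction n as [|n IH]; intros s; [simpl; ring|].
  cbn [bernsteinR]. rewrite IH.
  rewrite (bernsteinR_ext n t _ (fun k => A + B * (INR k + (1 + s)) ^ 2)).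
  - rewrite IH, S_INR. ring.
  - intros k. rewrite S_INR. f_equal. f_equal. ring.
Qed.

Lemma bernsteinR_variance (n : nat) (t A B : R) :
  bernsteinR n t (fun k => A + B * (INR k - INR n * t) ^ 2) = A + B * (INR n * t * (1 - t)).
Proof.
  rewrite (bernsteinR_ext n t _ (fun k => A + B * (INR k + - (INR n * t)) ^ 2)).
  - rewrite bernsteinR_second_moment. ring.
  - reflexivity.
Qed.

(** * The algebra of functions that agree with Laurent polynomials on a set *)

(** Agreement only on [K] admits functions that are not holomorphic: on the circle conjugation is
    [1/z], so both coordinates qualify. *)
Definition laurent_representable (K : C -> Prop) (c : C) (adm : Z -> Prop) (f : C -> C) : Prop :=
  exists l, admissible adm l /\ forall z, K z -> laurent c l z = f z.

Lemma laurent_representable_monomial (K : C -> Prop) (c : C) (adm : Z -> Prop) (a : C) (j : Z) :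
  adm j -> laurent_representable K c adm (fun z => a * Czpow (z - c) j)%C.
Proof.
  intros H. exists ((a, j) :: nil). split; [now repeat constructor|].
  intros z _. simpl. ring.
Qed.

Lemma laurent_representable_plus (K : C -> Prop) (c : C) (adm : Z -> Prop) (f g : C -> C) :
  laurent_representable K c adm f -> laurent_representable K c adm g ->
  laurent_representable K c adm (fun z => f z + g z)%C.
Proof.
  intros [l [Hl1 Hl2]] [m [Hm1 Hm2]]. exists (l ++ m). split.
  - now apply Forall_app.
  - intros z Kz. now rewrite laurent_app, Hl2, Hm2.
Qed.

Lemma laurent_representable_mult (K : C -> Prop) (c : C) (adm : Z -> Prop) (f g : C -> C) :
  ~ K c -> (forall i j, adm i -> adm j -> adm (i + j)%Z) ->
  laurent_representable K c adm f -> laurent_representable K c adm g ->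
  laurent_representable K c adm (fun z => f z * g z)%C.
Proof.
  intros Hc Hadm [l [Hl1 Hl2]] [m [Hm1 Hm2]].
  assert (Hterm : forall a i, adm i -> forall m, admissible adm m ->
    exists p, admissible adm p /\ forall z, K z ->
      laurent c p z = (a * Czpow (z - c) i * laurent c m z)%C).
  { intros a i Hi q. induction q as [|[b j] q IH]; intros Hq.
    - exists nil. split; [constructor|]. intros z _. simpl. ring.
    - inversion Hq as [|? ? Hj Hq']; subst. destruct (IH Hq') as [p [Hp1 Hp2]].
      exists (((a * b)%C, (i + j)%Z) :: p). split.
      + constructor; [now apply Hadm|exact Hp1].
      + intros z Kz. simpl. rewrite Hp2 by exact Kz. rewrite Czpow_add; [ring|].
        intros E. apply Hc. apply Cminus_eq_0 in E. now subst. }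
  assert (G : forall l, admissible adm l -> exists p, admissible adm p /\ forall z, K z ->
      laurent c p z = (laurent c l z * laurent c m z)%C).
  { intros q. induction q as [|[a i] q IH]; intros Hq.
    - exists nil. split; [constructor|]. intros z _. simpl. ring.
    - inversion Hq as [|? ? Hi Hq']; subst. destruct (IH Hq') as [p [Hp1 Hp2]].
      destruct (Hterm a i Hi m Hm1) as [p' [Hp1' Hp2']].
      exists (p' ++ p). split; [now apply Forall_app|].
      intros z Kz. rewrite laurent_app, Hp2, Hp2' by exact Kz. simpl. ring. }
  destruct (G l Hl1) as [p [Hp1 Hp2]]. exists p. split; [exact Hp1|].
  intros z Kz. rewrite Hp2, Hl2, Hm2 by exact Kz. reflexivity.
Qed.

Lemma laurent_representable_ext (K : C -> Prop) (c : C) (adm : Z -> Prop) (f g : C -> C) :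
  (forall z, K z -> f z = g z) ->
  laurent_representable K c adm f -> laurent_representable K c adm g.
Proof.
  intros E [l [Hl1 Hl2]]. exists l. split; [exact Hl1|].
  intros z Kz. rewrite Hl2 by exact Kz. now apply E.
Qed.

Lemma laurent_representable_const (K : C -> Prop) (c : C) (adm : Z -> Prop) (a : C) :
  adm 0%Z -> laurent_representable K c adm (fun _ => a).
Proof.
  intros H. apply laurent_representable_ext with (fun z => a * Czpow (z - c) 0)%C.
  - intros z _. rewrite Czpow_0. ring.
  - now apply laurent_representable_monomial.
Qed.

(** The values [phi k] may depend on [z], so the lemma can be nested to treat two variables. *)
Lemma laurent_representable_bernstein (K : C -> Prop) (c : C) (adm : Z -> Prop)
    (n : nat) (t : C -> C) (phi : nat -> C -> C) :
  ~ K c -> adm 0%Z -> (forall i j, adm i -> adm j -> adm (i + j)%Z) ->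
  laurent_representable K c adm t -> (forall k, laurent_representable K c adm (phi k)) ->
  laurent_representable K c adm (fun z => bernstein n (t z) (fun k => phi k z)).
Proof.
  intros Hc adm0 Hadm Ht. revert phi. induction n as [|n IH]; intros phi Hphi; [apply Hphi|].
  simpl. apply laurent_representable_plus.
  - apply laurent_representable_mult; auto.
    apply laurent_representable_ext with (fun z => 1 + (- (1)) * t z)%C.
    + intros z _. ring.
    + apply laurent_representable_plus; [now apply laurent_representable_const|].
      apply laurent_representable_mult; auto. now apply laurent_representable_const.
  - apply laurent_representable_mult; auto.
Qed.

(** Trades a distance for its square, so that the second moment suffices. *)
Lemma le_young (x eta : R) : 0 < eta -> x <= eta + / eta * x ^ 2.
Proof.
  intros H. apply (Rmult_le_reg_r eta); [exact H|].
  replace ((eta + / eta * x ^ 2) * eta) with (eta ^ 2 + x ^ 2) by (field; lra).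
  nra.
Qed.

(** Pulls back to the extreme value theorem on [[0,1]]. That theorem asks for two-sided continuity
    at the end points, so [p] maps all of [R] into [K]. *)
Lemma bounded_continuous_curve (K : C -> Prop) (p : R -> C) (Lam : R) :
  0 <= Lam -> (forall t, K (p t)) ->
  (forall s t, Cmod (p s - p t) <= Lam * Rabs (s - t)) ->
  (forall z, K z -> exists t, 0 <= t <= 1 /\ p t = z) ->
  bounded_continuous K.
Proof.
  intros HL HK Hlip Hsurj phi Hphi.
  destruct (continuity_ab_maj (fun t => Cmod (phi (p t))) 0 1) as [m [Hm _]]; [lra| |].
  - intros t _ eps He.
    destruct (Hphi _ (HK t) eps He) as [d [Hd H]].
    assert (Hd2 : 0 < d / (Lam + 1)) by (apply Rdiv_lt_0_compat; lra).
    exists (d / (Lam + 1)). split; [exact Hd2|].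
    intros s [_ Hs]. simpl in Hs. unfold Rdist in Hs.
    apply (Rmult_lt_compat_l (Lam + 1)) in Hs; [|lra].
    replace ((Lam + 1) * (d / (Lam + 1))) with d in Hs by (field; lra).
    assert (Ha := Rabs_pos (s - t)).
    assert (Hst := Hlip s t).
    assert (Hc : Cmod (phi (p s) - phi (p t)) < eps) by (apply H; [apply HK|lra]).
    simpl. unfold Rdist.
    assert (T1 := Cmod_minus_triangle (phi (p s)) (phi (p t)) 0).
    assert (T2 := Cmod_minus_triangle (phi (p t)) (phi (p s)) 0).
    rewrite (Cmod_minus_sym (phi (p t)) (phi (p s))) in T2.
    replace (phi (p s) - 0)%C with (phi (p s)) in T1, T2 by ring.
    replace (phi (p t) - 0)%C with (phi (p t)) in T1, T2 by ring.
    apply Rabs_def1; lra.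
  - exists (Cmod (phi (p m))). split; [apply Cmod_ge_0|].
    intros z Kz. destruct (Hsurj z Kz) as [t [Ht <-]]. now apply Hm.
Qed.

(** * The segment *)

(** Keeps the affine parametrisation inside the segment for every real parameter. *)
Definition clamp (t : R) : R := Rmax 0 (Rmin 1 t).

Lemma clamp_bounds (t : R) : 0 <= clamp t <= 1.
Proof.
  unfold clamp. split; [apply Rmax_l|]. apply Rmax_lub; [lra|apply Rmin_l].
Qed.

Lemma clamp_id (t : R) : 0 <= t <= 1 -> clamp t = t.
Proof. intros H. unfold clamp. rewrite Rmin_right, Rmax_right; lra. Qed.

Lemma clamp_lipschitz (s t : R) : Rabs (clamp s - clamp t) <= Rabs (s - t).
Proof.
  unfold clamp, Rmax, Rmin.
  repeat destruct Rle_dec; unfold Rabs; repeat destruct Rcase_abs; lra.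
Qed.

Lemma path_bound_segment (a b : R) : path_bound (segment a b) 1.
Proof.
  intros z w [x [Hx ->]] [y [Hy ->]].
  exists (fun t => RtoC (x + clamp t * (y - x))), (fun _ => RtoC (y - x)).
  assert (E : forall u v, (RtoC u - RtoC v)%C = RtoC (u - v)) by (intros; now rewrite RtoC_minus).
  repeat split.
  - rewrite clamp_id by lra. f_equal. ring.
  - rewrite clamp_id by lra. f_equal. ring.
  - intros t. exists (x + clamp t * (y - x)). split; [|reflexivity].
    assert (H := clamp_bounds t). nra.
  - intros s t. rewrite !E, !Cmod_R.
    replace (x + clamp s * (y - x) - (x + clamp t * (y - x)))
      with ((y - x) * (clamp s - clamp t)) by ring.
    rewrite Rabs_mult, Rmult_1_l.
    apply Rmult_le_compat_l; [apply Rabs_pos|apply clamp_lipschitz].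
  (* Within this radius [clamp] is the identity and the path is affine. *)
  - intros t Ht eps He. exists (Rmin t (1 - t)). split; [apply Rmin_glb_lt; lra|].
    intros s Hs.
    assert (H1 := Rlt_le_trans _ _ _ Hs (Rmin_l _ _)).
    assert (H2 := Rlt_le_trans _ _ _ Hs (Rmin_r _ _)).
    apply Rabs_def2 in H1, H2.
    rewrite !clamp_id by lra.
    rewrite <- RtoC_mult, !E.
    replace (x + s * (y - x) - (x + t * (y - x)) - (y - x) * (s - t)) with 0 by ring.
    rewrite Cmod_0. apply Rmult_le_pos; [lra|apply Rabs_pos].
  - intros t. rewrite E. lra.
Qed.

Lemma interior_segment (a b : R) (z : C) : ~ Defs.interior (segment a b) z.
Proof.
  intros H. apply locally_Cmod in H. destruct H as [d [Hd H]].
  destruct (H z) as [x [_ Ez]]; [rewrite Cmod_minus_self; exact Hd|].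
  destruct (H (z + RtoC (d / 2) * Ci)%C) as [y [_ Ey]].
  - replace (z + RtoC (d / 2) * Ci - z)%C with (RtoC (d / 2) * Ci)%C by ring.
    rewrite Cmod_mult, Cmod_Ci, Cmod_R, Rabs_pos_eq by lra. lra.
  - apply (f_equal snd) in Ey, Ez. simpl in Ey, Ez. lra.
Qed.

Lemma bounded_continuous_segment (a b : R) : a < b -> bounded_continuous (segment a b).
Proof.
  intros Hab. apply bounded_continuous_curve with (fun t => RtoC (a + clamp t * (b - a))) (b - a).
  - lra.
  - intros t. exists (a + clamp t * (b - a)). split; [|reflexivity].
    assert (H := clamp_bounds t). nra.
  - intros s t. rewrite <- RtoC_minus, Cmod_R.
    replace (a + clamp s * (b - a) - (a + clamp t * (b - a)))
      with ((b - a) * (clamp s - clamp t)) by ring.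
    rewrite Rabs_mult, Rabs_pos_eq by lra.
    apply Rmult_le_compat_l; [lra|apply clamp_lipschitz].
  - intros z [x [Hx ->]]. exists ((x - a) / (b - a)).
    assert (H : 0 <= (x - a) / (b - a) <= 1).
    { split.
      - apply Rmult_le_pos; [lra|]. left. apply Rinv_0_lt_compat. lra.
      - apply (Rmult_le_reg_r (b - a)); [lra|].
        replace ((x - a) / (b - a) * (b - a)) with (x - a) by (field; lra). lra. }
    split; [exact H|]. rewrite clamp_id by exact H. f_equal. field. lra.
Qed.

Lemma residue_bound_nonneg (K : C -> Prop) (c : C) :
  residue_bound K c (fun j => (0 <= j)%Z) 0.
Proof.
  intros l _ _ d Hl _ _. rewrite Rmult_0_l.
  replace (laurent_residue l) with (RtoC 0); [rewrite Cmod_0; lra|].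
  induction Hl as [|[a j] l Hj _ IH]; [reflexivity|]. simpl in *.
  destruct (Z.eq_dec j (-1)); [lia|exact IH].
Qed.

Lemma exists_INR_ge (x : R) : exists n : nat, (0 < n)%nat /\ x <= INR n.
Proof.
  destruct (INR_unbounded x) as [n Hn]. exists (S n). split; [lia|].
  rewrite S_INR. lra.
Qed.

(** [lipschitz_approximable] fixes no sign for its constant; this makes it nonnegative. *)
Lemma lipschitz_abs (K : C -> Prop) (h : C -> C) (Lam : R) :
  (forall z w, K z -> K w -> Cmod (h w - h z) <= Lam * Cmod (w - z)) ->
  forall z w, K z -> K w -> Cmod (h w - h z) <= Rabs Lam * Cmod (w - z).
Proof.
  intros H z w Kz Kw. eapply Rle_trans; [now apply H|].
  apply Rmult_le_compat_r; [apply Cmod_ge_0|apply Rle_abs].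
Qed.

(** The Bernstein error is at most [Lam * eta] plus [Lam * (b - a)^2 / (eta * N)]: first [eta], then
    [n], makes each at most [eps / 2]. The centre [a - 1] is a convenient point off the segment. *)
Lemma lipschitz_approximable_segment (a b : R) :
  a < b -> lipschitz_approximable (segment a b) (RtoC (a - 1)) (fun j => (0 <= j)%Z).
Proof.
  intros Hab h Lam0 Hh0 eps He.
  assert (Hh := lipschitz_abs _ _ _ Hh0). assert (HL := Rabs_pos Lam0).
  set (Lam := Rabs Lam0) in *. clearbody Lam. clear Hh0.
  set (eta := eps / (2 * (Lam + 1))).
  assert (Heta : 0 < eta) by (apply Rdiv_lt_0_compat; lra).
  assert (Heta1 : Lam * eta <= eps / 2).
  { apply Rle_trans with ((Lam + 1) * eta).
    - apply Rmult_le_compat_r; lra.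
    - right. unfold eta. field. lra. }
  destruct (exists_INR_ge (2 * Lam * (b - a) ^ 2 / eta / eps)) as [n [Hn0 Hn]].
  apply lt_0_INR in Hn0. set (N := INR n) in *.
  assert (HN : Lam * (b - a) ^ 2 / eta / N <= eps / 2).
  { apply (Rmult_le_reg_r (N * 2 / eps)); [apply Rdiv_lt_0_compat; lra|].
    replace (eps / 2 * (N * 2 / eps)) with N by (field; lra).
    replace (Lam * (b - a) ^ 2 / eta / N * (N * 2 / eps)) with
      (2 * Lam * (b - a) ^ 2 / eta / eps) by (field; lra). exact Hn. }
  pose (p := fun k : nat => RtoC (a + (b - a) * INR k / N)).
  assert (Kp : forall k, (k <= n)%nat -> segment a b (p k)).
  { intros k Hk. exists (a + (b - a) * INR k / N). split; [|reflexivity].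
    assert (H0 := pos_INR k). apply le_INR in Hk. fold N in Hk.
    assert (H1 : 0 <= INR k / N <= 1).
    { split; [apply Rdiv_le_0_compat; lra|].
      apply (Rmult_le_reg_r N); [lra|]. unfold Rdiv. rewrite Rmult_assoc, Rinv_l by lra. lra. }
    unfold Rdiv in *. rewrite Rmult_assoc. nra. }
  destruct (laurent_representable_bernstein (segment a b) (RtoC (a - 1)) (fun j => (0 <= j)%Z)
    n (fun z => (z - RtoC a) / RtoC (b - a))%C (fun k _ => h (p k))) as [l [Hl1 Hl2]].
  - intros [x [Hx E]]. apply RtoC_inj in E. lra.
  - lia.
  - intros; lia.
  - apply laurent_representable_ext with
      (fun z => / RtoC (b - a) * Czpow (z - RtoC (a - 1)) 1 +
                - / RtoC (b - a) * Czpow (z - RtoC (a - 1)) 0)%C.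
    + intros z _. rewrite Czpow_1, Czpow_0, !RtoC_minus. field.
      rewrite <- RtoC_minus. intros E. apply RtoC_inj in E. lra.
    + apply laurent_representable_plus; apply laurent_representable_monomial; lia.
  - intros k. apply laurent_representable_const. lia.
  - exists l. split; [exact Hl1|]. intros z Kz. rewrite Hl2 by exact Kz.
    destruct Kz as [x [Hx ->]].
    set (t := (x - a) / (b - a)).
    assert (Ht : 0 <= t <= 1).
    { split.
      - apply Rdiv_le_0_compat; lra.
      - apply (Rmult_le_reg_r (b - a)); [lra|]. unfold t.
        replace ((x - a) / (b - a) * (b - a)) with (x - a) by (field; lra). lra. }
    replace ((RtoC x - RtoC a) / RtoC (b - a))%C with (RtoC t)
      by (unfold t; rewrite RtoC_div, RtoC_minus; [reflexivity|lra]).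
    eapply Rle_trans.
    + apply (bernstein_dist_le n t _
        (fun k => Lam * eta + Lam * (b - a) ^ 2 / eta / N ^ 2 * (INR k - N * t) ^ 2));
        [exact Ht|].
      intros k Hk. eapply Rle_trans.
      * apply Hh; [now exists x|now apply Kp].
      * unfold p. rewrite <- RtoC_minus, Cmod_R.
        eapply Rle_trans; [apply Rmult_le_compat_l; [exact HL|apply (le_young _ eta Heta)]|].
        right. rewrite <- Rsqr_pow2, <- Rsqr_abs, Rsqr_pow2.
        unfold t. field. lra.
    + unfold N at 2. rewrite bernsteinR_variance. fold N.
      apply Rle_trans with (Lam * eta + Lam * (b - a) ^ 2 / eta / N * 1); [|lra].
      apply Rplus_le_compat_l.
      replace (Lam * (b - a) ^ 2 / eta / N ^ 2 * (N * t * (1 - t)))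
        with (Lam * (b - a) ^ 2 / eta / N * (t * (1 - t))) by (field; lra).
      apply Rmult_le_compat_l; [|nra].
      unfold Rdiv. repeat apply Rmult_le_pos; try lra; try (left; apply Rinv_0_lt_compat; lra).
Qed.

(** * The circle *)

Definition cis (t : R) : C := (cos t, sin t).

Lemma Cmod_cis (t : R) : Cmod (cis t) = 1.
Proof.
  rewrite <- sqrt_1. unfold Cmod, cis. apply f_equal. simpl.
  assert (H := sin2_cos2 t). unfold Rsqr in H. lra.
Qed.

Lemma Cmod_1_cis (z : C) : Cmod z = 1 -> exists t, - PI <= t <= PI /\ z = cis t.
Proof.
  intros H. destruct z as [x y].
  assert (Hxy : x ^ 2 + y ^ 2 = 1).
  { assert (E := Cmod2_alt (x, y)). rewrite H in E. unfold Re, Im in E. cbn [fst snd] in E. lra. }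
  assert (Hx : -1 <= x <= 1) by (split; nra).
  assert (Hb := acos_bound x).
  assert (Es : sqrt (1 - Rsqr x) = Rabs y).
  { rewrite <- sqrt_Rsqr_abs. f_equal. unfold Rsqr. lra. }
  destruct (Rle_dec 0 y) as [Hy|Hy].
  - exists (acos x). split; [lra|]. unfold cis. rewrite cos_acos, sin_acos, Es by exact Hx.
    now rewrite Rabs_pos_eq.
  - exists (- acos x). split; [lra|]. unfold cis.
    rewrite cos_neg, sin_neg, cos_acos, sin_acos, Es by exact Hx.
    rewrite Rabs_left by lra. f_equal. ring.
Qed.

Lemma unit_circle_Cmod (z : C) : unit_circle z <-> Cmod z = 1.
Proof.
  split.
  - intros [t ->]. apply Cmod_cis.
  - intros H. destruct (Cmod_1_cis z H) as [t [_ ->]]. now exists t.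
Qed.

Lemma cis_lipschitz (s t : R) : Cmod (cis s - cis t) <= 2 * Rabs (s - t).
Proof.
  eapply Rle_trans; [apply Cmod_le_abs|]. simpl.
  replace (2 * Rabs (s - t)) with (1 * Rabs (s - t) + 1 * Rabs (s - t)) by ring.
  apply Rplus_le_compat.
  - apply (bounded_variation cos (fun x => - sin x)). intros x _. split; [apply is_derive_cos|].
    rewrite Rabs_Ropp. apply Rabs_le. apply SIN_bound.
  - apply (bounded_variation sin cos). intros x _. split; [apply is_derive_sin|].
    apply Rabs_le. apply COS_bound.
Qed.

(** From [u - u^3 / 6 <= sin u] and [u^2 <= 4]. *)
Lemma sin_ge_third (u : R) : 0 <= u <= 2 -> u / 3 <= sin u.
Proof.
  intros Hu. destruct (pre_sin_bound u 0) as [H _]; [lra|lra|].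
  unfold sin_approx, sin_term in H. simpl in H. nra.
Qed.

(** The chord has length [2 * sin (Rabs t / 2)], and [PI / 2 <= 2] allows the linear lower bound on
    the sine. *)
Lemma Rabs_le_cis_chord (t : R) : - PI <= t <= PI -> Rabs t <= 3 * Cmod (cis t - 1).
Proof.
  intros Ht. assert (HPI := PI_4).
  assert (E : Cmod (cis t - 1) ^ 2 = (2 * sin (Rabs t / 2)) ^ 2).
  { rewrite Cmod2_alt. simpl.
    assert (Ec : cos t = cos (Rabs t)).
    { unfold Rabs. destruct Rcase_abs; [now rewrite cos_neg|reflexivity]. }
    assert (E2 := cos_2a_sin (Rabs t / 2)). replace (2 * (Rabs t / 2)) with (Rabs t) in E2 by field.
    assert (E3 := sin2_cos2 t). unfold Rsqr in E3. nra. }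
  assert (Ha := Rabs_pos t).
  assert (Hb : Rabs t <= PI) by (apply Rabs_le; lra).
  assert (Hs := sin_ge_third (Rabs t / 2)).
  assert (Hc := Cmod_ge_0 (cis t - 1)).
  assert (Hd : Cmod (cis t - 1) = 2 * sin (Rabs t / 2)) by (apply Rsqr_inj; [lra|lra|];
    rewrite !Rsqr_pow2; exact E).
  lra.
Qed.

Lemma curve_diff_cis (z : C) (th t : R) :
  curve_diff (fun s => z * cis (th * s))%C t (z * (RtoC th * Ci) * cis (th * t)).
Proof.
  apply curve_diff_components. destruct z as [x y]. simpl. split.
  - auto_derive; [easy|]. ring.
  - auto_derive; [easy|]. ring.
Qed.

(** The path rotates [z] to [w] through an angle in [[-PI, PI]]. The constant is 3 for arc against
    chord times 2 from [cis_lipschitz]. *)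
Lemma path_bound_circle : path_bound unit_circle 6.
Proof.
  intros z w Kz Kw. apply unit_circle_Cmod in Kz, Kw.
  assert (Hz : z <> 0) by (apply Cmod_gt_0; lra).
  destruct (Cmod_1_cis (w / z)) as [th [Hth Eth]].
  { rewrite Cmod_div, Kz, Kw by exact Hz. field. }
  assert (Ew : w = (z * cis th)%C) by (rewrite <- Eth; field; exact Hz).
  assert (Hwz : Rabs th <= 3 * Cmod (w - z)).
  { replace (w - z)%C with (z * (cis th - 1))%C by (rewrite Ew; ring).
    rewrite Cmod_mult, Kz, Rmult_1_l. now apply Rabs_le_cis_chord. }
  exists (fun t => z * cis (th * t))%C, (fun t => z * (RtoC th * Ci) * cis (th * t))%C.
  repeat split.
  - rewrite Rmult_0_r. unfold cis. rewrite cos_0, sin_0. change (1, 0) with (RtoC 1). ring.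
  - now rewrite Rmult_1_r.
  - intros t. apply unit_circle_Cmod. rewrite Cmod_mult, Cmod_cis. lra.
  - intros s t. replace (z * cis (th * s) - z * cis (th * t))%C
      with (z * (cis (th * s) - cis (th * t)))%C by ring.
    rewrite Cmod_mult, Kz, Rmult_1_l. eapply Rle_trans; [apply cis_lipschitz|].
    replace (th * s - th * t) with (th * (s - t)) by ring. rewrite Rabs_mult.
    assert (Ha := Rabs_pos (s - t)). nra.
  - intros t _. apply curve_diff_cis.
  - intros t. rewrite !Cmod_mult, Kz, Cmod_cis, Cmod_Ci, Cmod_R.
    assert (Ha := Cmod_ge_0 (w - z)). lra.
Qed.

Lemma interior_circle (z : C) : ~ Defs.interior unit_circle z.
Proof.
  intros H. apply locally_Cmod in H. destruct H as [d [Hd H]].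
  assert (Hz : Cmod z = 1).
  { apply unit_circle_Cmod. apply H. now rewrite Cmod_minus_self. }
  assert (Hw : Cmod (RtoC (1 + d / 2) * z) = 1).
  { apply unit_circle_Cmod. apply H.
    replace (RtoC (1 + d / 2) * z - z)%C with (RtoC (d / 2) * z)%C by (rewrite RtoC_plus; ring).
    rewrite Cmod_mult, Hz, Cmod_R, Rabs_pos_eq by lra. lra. }
  rewrite Cmod_mult, Hz, Cmod_R, Rabs_pos_eq in Hw by lra. lra.
Qed.

Lemma bounded_continuous_circle : bounded_continuous unit_circle.
Proof.
  assert (HPI := PI_RGT_0).
  apply bounded_continuous_curve with (fun t => cis (2 * PI * t - PI)) (4 * PI).
  - lra.
  - intros t. now exists (2 * PI * t - PI).
  - intros s t. eapply Rle_trans; [apply cis_lipschitz|].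
    replace (2 * PI * s - PI - (2 * PI * t - PI)) with (2 * PI * (s - t)) by ring.
    rewrite Rabs_mult, (Rabs_pos_eq (2 * PI)) by lra. lra.
  - intros z Kz. apply unit_circle_Cmod in Kz.
    destruct (Cmod_1_cis z Kz) as [t [Ht ->]]. exists ((t + PI) / (2 * PI)). split.
    + split; [apply Rdiv_le_0_compat; lra|].
      apply (Rmult_le_reg_r (2 * PI)); [lra|].
      replace ((t + PI) / (2 * PI) * (2 * PI)) with (t + PI) by (field; lra). lra.
    + f_equal. field. lra.
Qed.

Lemma curve_diff_cont (u : R -> C) (t : R) (l : C) :
  curve_diff u t l ->
  forall eps, 0 < eps -> exists d, 0 < d /\ forall s, Rabs (s - t) < d -> Cmod (u s - u t) < eps.
Proof.
  intros H eps He. destruct (H 1 Rlt_0_1) as [d [Hd H']].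
  assert (Hl := Cmod_ge_0 l).
  assert (He' : 0 < eps / (Cmod l + 1)) by (apply Rdiv_lt_0_compat; lra).
  exists (Rmin d (eps / (Cmod l + 1))). split; [now apply Rmin_glb_lt|].
  intros s Hs.
  assert (Hs2 := Rlt_le_trans _ _ _ Hs (Rmin_r _ _)).
  specialize (H' s (Rlt_le_trans _ _ _ Hs (Rmin_l _ _))).
  replace (u s - u t)%C with ((u s - u t - l * RtoC (s - t)) + l * RtoC (s - t))%C by ring.
  eapply Rle_lt_trans; [apply Cmod_triangle|]. rewrite Cmod_mult, Cmod_R.
  apply (Rmult_lt_compat_r (Cmod l + 1)) in Hs2; [|lra].
  replace (eps / (Cmod l + 1) * (Cmod l + 1)) with eps in Hs2 by (field; lra).
  lra.
Qed.

(* [dg] is the derivative of a function on the closed curve, so going once around the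
   circle isolates the residue of [l] up to the approximation error. *)
Lemma residue_bound_circle : residue_bound unit_circle 0 (fun _ => True) 2.
Proof.
  intros l g dg d _ Hg Hd. assert (HPI := PI_RGT_0).
  set (r := laurent_residue l).
  set (P := laurent_primitive (laurent_strip l)).
  (* The factor 1 matches the form of [curve_diff_cis]. *)
  set (gam := fun t => (1 * cis (2 * PI * t))%C).
  set (dgam := fun t => (1 * (RtoC (2 * PI) * Ci) * cis (2 * PI * t))%C).
  assert (Kgam : forall t, unit_circle (gam t)).
  { intros t. apply unit_circle_Cmod. unfold gam. rewrite Cmod_mult, Cmod_cis, Cmod_1. ring. }
  assert (N0 : forall z, unit_circle z -> z <> 0).
  { intros z Kz. apply unit_circle_Cmod in Kz. apply Cmod_gt_0. lra. }
  set (q := (RtoC (2 * PI) * Ci)%C).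
  assert (Hq : Cmod q = 2 * PI).
  { unfold q. rewrite Cmod_mult, Cmod_Ci, Cmod_R, Rabs_pos_eq; lra. }
  (* Along [gam] the function [q * t] is a logarithm, so [r * q * t] integrates the stripped term
     [r / z]. It alone fails to close up: [u 1 - u 0] is [r * q], that is [2 * PI * i * r]. *)
  set (u := fun t => ((laurent 0 P (gam t) - g (gam t)) + r * q * RtoC t)%C).
  set (du := fun t => ((laurent 0 l (gam t) - dg (gam t)) * dgam t)%C).
  assert (Hu : forall t, curve_diff u t (du t)).
  { intros t.
    assert (H := curve_diff_comp unit_circle (fun z => laurent 0 P z - g z)%C gam t
      (laurent 0 (laurent_deriv P) (gam t) - dg (gam t))%C (dgam t) Kgam).
    assert (H2 : curve_diff (fun s => laurent 0 P (gam s) - g (gam s))%C t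
       ((laurent 0 (laurent_deriv P) (gam t) - dg (gam t)) * dgam t)).
    { apply H.
      - apply within_diff_sub; [|now apply Hg].
        apply (within_diff_mono _ (fun _ => True)); [easy|].
        apply within_diff_laurent. now apply N0.
      - apply curve_diff_cis. }
    clear H. intros eps He. destruct (H2 eps He) as [e [He0 He1]].
    exists e. split; [exact He0|]. intros s Hs. specialize (He1 s Hs).
    replace (u s - u t - du t * RtoC (s - t))%C with
      (laurent 0 P (gam s) - g (gam s) - (laurent 0 P (gam t) - g (gam t)) -
       (laurent 0 (laurent_deriv P) (gam t) - dg (gam t)) * dgam t * RtoC (s - t))%C;
      [exact He1|].
    unfold u, du. unfold P at 3. rewrite laurent_deriv_primitive.
    assert (E := laurent_derivs_strip 0 0 l (gam t)).
    change (laurent 0 l (gam t) = (laurent 0 (laurent_strip l) (gam t) +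
      r * (1 * Czpow (gam t - 0) (-1) + 0))%C) in E.
    rewrite E, Czpow_m1.
    assert (Eg : dgam t = (q * gam t)%C) by (unfold dgam, gam, q; ring).
    rewrite Eg, RtoC_minus. assert (Hn := N0 _ (Kgam t)).
    set (X := laurent 0 P (gam s)). set (Y := laurent 0 P (gam t)).
    set (W := laurent 0 (laurent_strip l) (gam t)).
    replace (gam t - 0)%C with (gam t) by ring. field. exact Hn. }
  assert (Hinc := curve_increment u du (2 * PI * d)).
  assert (E : (u 1 - u 0)%C = (r * q)%C).
  { assert (Eg : gam 1 = gam 0).
    { unfold gam. rewrite Rmult_1_r, Rmult_0_r. unfold cis.
      now rewrite cos_2PI, sin_2PI, cos_0, sin_0. }
    unfold u. rewrite Eg. ring. }
  rewrite E, Cmod_mult, Hq in Hinc.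
  assert (Hr : Cmod r * (2 * PI) <= 2 * (2 * PI * d)).
  { apply Hinc.
    - intros t _. apply Hu.
    - intros t _. exact (curve_diff_cont _ _ _ (Hu t)).
    - intros t _. unfold du. rewrite Cmod_mult.
      replace (Cmod (dgam t)) with (2 * PI).
      + rewrite Rmult_comm. apply Rmult_le_compat_l; [lra|]. now apply Hd.
      + unfold dgam. fold q. rewrite !Cmod_mult, Hq, Cmod_cis, Cmod_1. ring. }
  apply (Rmult_le_reg_r (2 * PI)); lra.
Qed.

Definition circle_retract (p : C) : C := if Ceq_dec p 0 then 1 else (p / RtoC (Cmod p))%C.

Lemma circle_retract_unit (p : C) : unit_circle (circle_retract p).
Proof.
  apply unit_circle_Cmod. unfold circle_retract. destruct Ceq_dec as [_|Hp]; [apply Cmod_1|].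
  assert (H := proj1 (Cmod_gt_0 p) Hp).
  rewrite Cmod_div, Cmod_R, Rabs_pos_eq; [field; lra|lra|].
  intros E. apply RtoC_inj in E. lra.
Qed.

(** For [p <> 0] the retraction moves [p] by the difference of its modulus from 1, at most
    [Cmod (p - z)]. For [p = 0] the right side is 2, the diameter, so any unit value would serve
    there. *)
Lemma circle_retract_dist (p z : C) :
  unit_circle z -> Cmod (circle_retract p - z) <= 2 * Cmod (p - z).
Proof.
  intros Kz. apply unit_circle_Cmod in Kz. unfold circle_retract.
  destruct Ceq_dec as [->|Hp].
  - rewrite (Cmod_minus_sym 0). replace (z - 0)%C with z by ring. rewrite Kz.
    eapply Rle_trans; [apply Cmod_triangle|]. rewrite Cmod_opp, Cmod_1, Kz. lra.
  - assert (H := proj1 (Cmod_gt_0 p) Hp).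
    eapply Rle_trans; [apply (Cmod_minus_triangle _ p)|].
    assert (E : Cmod (p / RtoC (Cmod p) - p) = Rabs (1 - Cmod p)).
    { assert (Hn : RtoC (Cmod p) <> 0) by (intros E; apply RtoC_inj in E; lra).
      replace (p / RtoC (Cmod p) - p)%C with (RtoC (1 - Cmod p) * (p / RtoC (Cmod p)))%C
        by (rewrite RtoC_minus; field; exact Hn).
      rewrite Cmod_mult, Cmod_R, Cmod_div, Cmod_R, (Rabs_pos_eq (Cmod p)) by (exact Hn || lra).
      field. lra. }
    rewrite E.
    assert (T1 := Cmod_minus_triangle p z 0). assert (T2 := Cmod_minus_triangle z p 0).
    rewrite (Cmod_minus_sym z p) in T2.
    replace (p - 0)%C with p in * by ring. replace (z - 0)%C with z in * by ring.
    rewrite Kz in *.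
    assert (Rabs (1 - Cmod p) <= Cmod (p - z)) by (apply Rabs_le; lra). lra.
Qed.

(* Two-dimensional Bernstein approximation on the square [[-1,1]^2]; the grid nodes are
   pushed to the circle, where [h] is controlled. *)
Lemma lipschitz_approximable_circle : lipschitz_approximable unit_circle 0 (fun _ => True).
Proof.
  intros h Lam0 Hh0 eps He.
  assert (Hh := lipschitz_abs _ _ _ Hh0). assert (HL := Rabs_pos Lam0).
  set (Lam := Rabs Lam0) in *. clearbody Lam. clear Hh0.
  set (eta := eps / (4 * (Lam + 1))).
  assert (Heta : 0 < eta) by (apply Rdiv_lt_0_compat; lra).
  assert (Heta1 : 2 * Lam * eta <= eps / 2).
  { apply Rle_trans with (2 * (Lam + 1) * eta).
    - apply Rmult_le_compat_r; lra.
    - right. unfold eta. field. lra. }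
  destruct (exists_INR_ge (16 * Lam / eta / eps)) as [n [Hn0 Hn]].
  apply lt_0_INR in Hn0. set (N := INR n) in *.
  assert (HN : 8 * Lam / eta / N <= eps / 2).
  { apply (Rmult_le_reg_r (N * 2 / eps)); [apply Rdiv_lt_0_compat; lra|].
    replace (eps / 2 * (N * 2 / eps)) with N by (field; lra).
    replace (8 * Lam / eta / N * (N * 2 / eps)) with (16 * Lam / eta / eps) by (field; lra).
    exact Hn. }
  pose (p := fun j k : nat => ((2 * INR j / N - 1, 2 * INR k / N - 1) : C)).
  assert (Hc : ~ unit_circle 0).
  { intros K0. apply unit_circle_Cmod in K0. rewrite Cmod_0 in K0. lra. }
  assert (Einv : forall z, unit_circle z -> (/ z)%C = (fst z, - snd z)).
  { intros z Kz. apply unit_circle_Cmod in Kz. assert (E := Cmod2_conj z).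
    assert (Hz : z <> 0) by (apply Cmod_gt_0; lra).
    rewrite Kz in E. replace (RtoC (1 ^ 2)) with (RtoC 1) in E by (f_equal; ring).
    change (fst z, - snd z) with (Cconj z).
    replace (/ z)%C with (/ z * (z * Cconj z))%C by (rewrite <- E; ring). field. exact Hz. }
  (* On the circle [x = (z + 1/z) / 2] and [y = (z - 1/z) / (2 i)], so the parameters [(1 + x) / 2]
     and [(1 + y) / 2] lie in the span of [1], [z], [1/z]. *)
  assert (Rep : forall a0 a1 a2 : C, laurent_representable unit_circle 0 (fun _ => True)
    (fun z => a0 * Czpow (z - 0) 0 + a1 * Czpow (z - 0) 1 + a2 * Czpow (z - 0) (-1))%C).
  { intros. repeat apply laurent_representable_plus; now apply laurent_representable_monomial. }
  destruct (laurent_representable_bernstein unit_circle 0 (fun _ => True) n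
    (fun z => RtoC ((1 + fst z) / 2))
    (fun j z => bernstein n (RtoC ((1 + snd z) / 2)) (fun k => h (circle_retract (p j k)))))
    as [l [Hl1 Hl2]]; auto.
  - apply laurent_representable_ext with (2 := Rep (RtoC (/ 2)) (RtoC (/ 4)) (RtoC (/ 4))).
    intros z Kz. replace (z - 0)%C with z by ring.
    rewrite Czpow_0, Czpow_1, Czpow_m1, Einv by exact Kz.
    destruct z as [x y]. unfold RtoC, Cplus, Cmult. simpl. f_equal; field.
  - intros j.
    apply (laurent_representable_bernstein unit_circle 0 (fun _ => True) n
      (fun z => RtoC ((1 + snd z) / 2)) (fun k _ => h (circle_retract (p j k)))); auto.
    + apply laurent_representable_ext with
        (2 := Rep (RtoC (/ 2)) (RtoC (- / 4) * Ci)%C (RtoC (/ 4) * Ci)%C).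
      intros z Kz. replace (z - 0)%C with z by ring.
      rewrite Czpow_0, Czpow_1, Czpow_m1, Einv by exact Kz.
      destruct z as [x y]. unfold RtoC, Ci, Cplus, Cmult. simpl. f_equal; field.
    + intros k. now apply laurent_representable_const.
  - exists l. split; [exact Hl1|]. intros z Kz. rewrite Hl2 by exact Kz.
    set (t := (1 + fst z) / 2). set (s := (1 + snd z) / 2).
    assert (Hxy : Rabs (fst z) <= 1 /\ Rabs (snd z) <= 1).
    { assert (E := proj1 (unit_circle_Cmod z) Kz). rewrite <- E.
      split; (eapply Rle_trans; [|apply Rmax_Cmod]); [apply Rmax_l|apply Rmax_r]. }
    destruct Hxy as [Hx Hy]. apply Rabs_le_between in Hx, Hy.
    assert (Ht : 0 <= t <= 1) by (unfold t; lra).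
    assert (Hs : 0 <= s <= 1) by (unfold s; lra).
    (* The 8 is 2 from the retraction times 4 from the squared grid spacing [2 / N]. *)
    set (B := 8 * Lam / eta / N ^ 2).
    assert (HB : 0 <= B).
    { unfold B, Rdiv. assert (0 < / N ^ 2) by (apply Rinv_0_lt_compat; apply pow_lt; lra).
      repeat apply Rmult_le_pos; try lra; left; apply Rinv_0_lt_compat; lra. }
    eapply Rle_trans.
    + apply (bernstein_dist_le n t _
        (fun j => (2 * Lam * eta + B * (N * s * (1 - s))) + B * (INR j - N * t) ^ 2)); [exact Ht|].
      intros j _. eapply Rle_trans.
      (* For fixed [j] the horizontal deviation is a constant of the inner average; only the
         vertical one is averaged here. *)
      * apply (bernstein_dist_le n s _
          (fun k => (2 * Lam * eta + B * (INR j - N * t) ^ 2) + B * (INR k - N * s) ^ 2));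
          [exact Hs|].
        intros k _. eapply Rle_trans; [apply Hh; [exact Kz|apply circle_retract_unit]|].
        eapply Rle_trans;
          [apply Rmult_le_compat_l; [exact HL|apply circle_retract_dist; exact Kz]|].
        eapply Rle_trans; [apply Rmult_le_compat_l;
          [exact HL|apply Rmult_le_compat_l; [lra|apply (le_young _ eta Heta)]]|].
        right. rewrite Cmod2_alt. unfold p, B, t, s. destruct z as [x y]. simpl. field. lra.
      * unfold N at 2. rewrite bernsteinR_variance. fold N. lra.
    + unfold N at 2. rewrite bernsteinR_variance. fold N.
      assert (Q : B * (N * s * (1 - s)) + B * (N * t * (1 - t)) <= B * N * 1).
      { replace (B * (N * s * (1 - s)) + B * (N * t * (1 - t)))
          with (B * N * (s * (1 - s) + t * (1 - t))) by ring.
        apply Rmult_le_compat_l; [|nra]. apply Rmult_le_pos; lra. }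
      replace (B * N * 1) with (8 * Lam / eta / N) in Q by (unfold B; field; lra).
      lra.
Qed.

Theorem mainTheorem5 :
  (forall a b : R, a < b ->
     forall g : nat -> C -> C,
       B_space (segment a b) g <-> Cinfty_space (segment a b) g) /\
  (forall g : nat -> C -> C,
     B_space unit_circle g <-> Cinfty_space unit_circle g).
Proof.
  split.
  - intros a b Hab g. split.
    + apply B_space_Cinfty with 1; [apply path_bound_segment|lra].
    + apply (Cinfty_B_space _ 1 (RtoC (a - 1)) (RtoC a) (fun j => (0 <= j)%Z) 0).
      * apply interior_segment.
      * apply path_bound_segment.
      * lra.
      * exists a. split; [lra|reflexivity].
      * intros [x [Hx E]]. apply RtoC_inj in E. lra.
      * now apply bounded_continuous_segment.
      * apply residue_bound_nonneg.
      * lra.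
      * now apply lipschitz_approximable_segment.
      * lia.
      * intros; lia.
  - intros g. split.
    + apply B_space_Cinfty with 6; [apply path_bound_circle|lra].
    + apply (Cinfty_B_space _ 6 0 1 (fun _ => True) 2); auto.
      * apply interior_circle.
      * apply path_bound_circle.
      * lra.
      * apply unit_circle_Cmod, Cmod_1.
      * intros K0. apply unit_circle_Cmod in K0. rewrite Cmod_0 in K0. lra.
      * apply bounded_continuous_circle.
      * apply residue_bound_circle.
      * lra.
      * apply lipschitz_approximable_circle.
Qed.
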